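(* Let $c\in P$ and let $\{\bar v_\delta(c)\}_\delta$ be a uniformly bounded sequence of time-$1$-periodic solutions of the discrete cell equation with $\delta=(h,\tau)\to0$, $0<\lambda_0\le\tau/h<\lambda_1$. Then there exist a subsequence of $\{\bar v_\delta(c)\}_\delta$, still denoted by the same symbol, and a viscosity solution $\bar v$ of $$v_t+H(x,t,c+v_x)=\bar H(c)\quad\text{in }\mathbb{T}^d\times\mathbb{T}$$ such that $$\max_{\{(m,k+1)\,:\,(x_m,t_{k+1})\in{\rm pr.}\,\tilde{\mathcal{G}}_\delta\}}|\bar v_\delta(c)^{k+1}_m-\bar v(x_m,t_{k+1})|\to0\quad\text{as }\delta\to0.$$
   Context: Lagrangian: $\mathbb{T}=\mathbb{R}/\mathbb{Z}$, $\mathbb{T}^d=\mathbb{R}^d/\mathbb{Z}^d$; functions on tori are identified with $1$-periodic functions. $|x|_\infty=\max_j|x^j|$, $|\cdot|$ is the Euclidean norm. $L=L(x,t,\zeta):\mathbb{T}^d\times\mathbb{T}\times\mathbb{R}^d\to\mathbb{R}$ is $C^2$; $L_{\zeta\zeta}$ is positive definite everywhere; for each $a\ge0$ there is $b(a)\in\mathbb{R}$ with $L\ge a|\zeta|+b(a)$ everywhere; there is $\alpha>0$ with $|L_{x^j}|\le\alpha(1+|L|)$ everywhere ($j=1,\dots,d$). $H(x,t,p)=\sup_{\zeta\in\mathbb{R}^d}(p\cdot\zeta-L(x,t,\zeta))$, $L^{(c)}(x,t,\zeta)=L(x,t,\zeta)-c\cdot\zeta$. $P\subset\mathbb{R}^d$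 is a fixed compact convex set and $r>0$ is a fixed number. $\bar H(c)$ is the unique real number for which $v_t+H(x,t,c+v_x)=\bar H(c)$ in $\mathbb{T}^d\times\mathbb{T}$ admits a viscosity solution. Grid: $\delta=(h,\tau)$, $h=(2N)^{-1}$, $\tau=(2K)^{-1}$ with $N,K\in\mathbb{N}$, $\lambda=\tau/h$; $x_m=hm$ ($m\in\mathbb{Z}^d$), $t_k=\tau k$ ($k\in\mathbb{Z}$). $G_{\rm even}$ (resp. $G_{\rm odd}$) is the set of $x_m$ with $m^1+\dots+m^d$ even (resp. odd). $\mathcal{G}_\delta=\bigcup_{k}\{(G_{\rm even}\times\{t_{2k}\})\cup(G_{\rm odd}\times\{t_{2k+1}\})\}$, $\tilde{\mathcal{G}}_\delta=\bigcup_{k}\{(G_{\rm odd}\times\{t_{2k}\})\cup(G_{\rm even}\times\{t_{2k+1}\})\}$; ${\rm pr.}\,\tilde{\mathcal{G}}_\delta$ is the set of $(x_m,t_k)\in\tilde{\mathcal{G}}_\delta$ with $0\le m^i\le2N-1$, $0\le k\le2K-1$. $e_1,\dots,e_d$ is the standard basis, $B=\{\pm e_1,\dots,\pm e_d\}$. For $v:\tilde{\mathcal{G}}_\delta\to\mathbb{R}$ write $v^k_m=v(x_m,t_k)$ and, for $(x_m,t_k)\in\mathcal{G}_\delta$, $(D_{x^j}v)^k_m=\frac{v^k_{m+e_j}-v^k_{m-e_j}}{2h}$, $D_xv=(D_{x^1}v,\dots,D_{x^d}v)$, $(D_tv)^{k+1}_m=\frac1\tau\big(v^{k+1}_m-\frac1{2d}\sum_{\omega\in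 B}v^k_{m+\omega}\big)$. Solution map: $X_\delta$ is the set of $w:G_{\rm odd}\to\mathbb{R}$, $1$-periodic in each coordinate, with $|D_xw|_\infty\le r$ on $G_{\rm even}$. For $v^0\in X_\delta$, $c\in P$, $\varphi^k_\delta(v^0;c)=v(\cdot,t_k)$, where $(D_tv)^{k+1}_m+H(x_m,t_k,c+(D_xv)^k_m)=0$, $v(\cdot,0)=v^0$; $\varphi_\delta=\varphi^{2K}_\delta$. $\bar H_\delta(c)$ is the unique real number for which some $\bar v^0\in X_\delta$ satisfies $\varphi_\delta(\bar v^0;c)+\bar H_\delta(c)=\bar v^0$. A time-$1$-periodic solution $\bar v_\delta(c)$ of the discrete cell equation is a function $\tilde{\mathcal{G}}_\delta\to\mathbb{R}$, $1$-periodic in each space coordinate and in time, whose restriction to time $0$ belongs to $X_\delta$ and which satisfies $(D_tv)^{k+1}_m+H(x_m,t_k,c+(D_xv)^k_m)=\bar H_\delta(c)$. Standing assumption: $r$ is large enough (depending only on $L$, $P$) and the $\delta$ considered are small enough, with $0<\lambda_0\le\lambda<\lambda_1$ for a constant $\lambda_1=\lambda_1(r,P)>0$ and a fixed $\lambda_0\in(0,\lambda_1)$, so that for every $c\in P$ and $v^0\in X_\delta$: $\varphi_\delta(\cdot;c)$ maps $X_\delta$ into itself; $|H_p(x_m,t_k,c+(D_xv)^k_m)|_\infty\le(d\lambda_1)^{-1}<(d\lambda)^{-1}$ for all $k\ge0$, $m$; and $v^{l+1}_n=\inf_\xi E\big[\sum_{0<k\le l+1}L^{(c)}(\gamma^k,t_{k-1},\xi^k_{m(\gamma^k)})\tau+v^0_{m(\gamma^0)}\big]$,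 where $m(x)$ is the index of a grid point $x$, the infimum is over controls $\xi$ with values in $[-(d\lambda)^{-1},(d\lambda)^{-1}]^d$, $\gamma$ is the backward random walk with $\gamma^{l+1}=x_n$ jumping from $(x_m,t_{k+1})$ to $(x_m+h\omega,t_k)$ with probability $\frac1{2d}-\frac\lambda2\omega\cdot\xi^{k+1}_m$ ($\omega\in B$), and the minimizing control is $\xi^{*\,k+1}_m=H_p(x_m,t_k,c+(D_xv)^k_m)$. *)

(* Defs.v *)
From HB Require Import structures.
From mathcomp Require Import all_boot all_order all_algebra.
From mathcomp Require Import all_classical all_reals all_analysis.

Set Implicit Arguments.
Unset Strict Implicit.
Unset Printing Implicit Defensive.
Import Order.TTheory GRing.Theory Num.Theory.
Import numFieldNormedType.Exports.
Local Open Scope classical_set_scope.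
Local Open Scope ring_scope.

(** Functions on the torus are 1-periodic functions on ['rV[R]_d] (and on [R]
    for the time variable).  On ['rV[R]_d] the library norm [`|x|] is the
    maximum norm; the Euclidean norm is [enorm] below. *)

Section Calculus.
Context {R : realType}.

Definition C1 (V W : normedModType R) (f : V -> W) : Prop :=
  (forall x, differentiable f x) /\ (forall u, continuous ('D_u f)).

Definition C2 (V W : normedModType R) (f : V -> W) : Prop :=
  C1 f /\ (forall u, C1 ('D_u f)).

Context {d : nat}.
Implicit Types (x y u v : 'rV[R]_d) (t : R).

Definition basis_vec (j : 'I_d) : 'rV[R]_d := delta_mx 0 j.

Definition dot u v : R := \sum_(j < d) u 0 j * v 0 j.

Definition enorm u : R := Num.sqrt (dot u u).

Definition gradient (f : 'rV[R]_d -> R) x : 'rV[R]_d :=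
  \row_j 'D_(basis_vec j) f x.

Definition hessian (f : 'rV[R]_d -> R) x : 'M[R]_d :=
  \matrix_(i, j) 'D_(basis_vec j) ('D_(basis_vec i) f) x.

Definition posdef (A : 'M[R]_d) : Prop :=
  forall u, u != 0 -> 0 < (u *m A *m u^T) 0 0.

End Calculus.

Section HamiltonJacobi.
Context {R : realType} {d : nat}.
Implicit Types (L H : 'rV[R]_d -> R -> 'rV[R]_d -> R).
Implicit Types (x zeta p c : 'rV[R]_d) (t a : R).

Record lagrangian L : Prop := Lagrangian {
  lagr_C2 : C2 (fun z : 'rV[R]_d * R * 'rV[R]_d => L z.1.1 z.1.2 z.2);
  lagr_periodic_x : forall j x t zeta, L (x + basis_vec j) t zeta = L x t zeta;
  lagr_periodic_t : forall x t zeta, L x (t + 1) zeta = L x t zeta;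
  lagr_convex : forall x t zeta, posdef (hessian (L x t) zeta);
  lagr_superlinear : forall a, 0 <= a ->
    exists b : R, forall x t zeta, a * enorm zeta + b <= L x t zeta;
  lagr_growth : exists2 alpha : R, 0 < alpha &
    forall j x t zeta,
      `|'D_(basis_vec j) (fun y => L y t zeta) x| <= alpha * (1 + `|L x t zeta|)
}.

Definition hamiltonian L x t p : R :=
  sup [set dot p zeta - L x t zeta | zeta in [set: 'rV[R]_d]].

Definition tilt L c x t zeta : R := L x t zeta - dot c zeta.

(* Viscosity solutions of v_t + H (x, t, c + v_x) = a; a function of
   (x, t) in the torus is a 1-periodic function of z = (x, t). *)

Definition grad_x (phi : 'rV[R]_d * R -> R) x t : 'rV[R]_d :=
  gradient (fun y => phi (y, t)) x.

Definition dt (phi : 'rV[R]_d * R -> R) x t : R := derive1 (fun s => phi (x, s)) t.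

Definition viscosity_sub H c a (v : 'rV[R]_d * R -> R) : Prop :=
  forall phi : 'rV[R]_d * R -> R, C1 phi -> forall x t,
    (\forall z \near (x, t), v z - phi z <= v (x, t) - phi (x, t)) ->
    dt phi x t + H x t (c + grad_x phi x t) <= a.

Definition viscosity_super H c a (v : 'rV[R]_d * R -> R) : Prop :=
  forall phi : 'rV[R]_d * R -> R, C1 phi -> forall x t,
    (\forall z \near (x, t), v (x, t) - phi (x, t) <= v z - phi z) ->
    a <= dt phi x t + H x t (c + grad_x phi x t).

Record viscosity_solution H c a (v : 'rV[R]_d * R -> R) : Prop :=
  ViscositySolution {
  visc_continuous : continuous v;
  visc_periodic_x : forall j x t, v (x + basis_vec j, t) = v (x, t);
  visc_periodic_t : forall x t, v (x, t + 1) = v (x, t);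
  visc_sub : viscosity_sub H c a v;
  visc_super : viscosity_super H c a v
}.

Definition is_effective_hamiltonian H c : R -> Prop :=
  unique (fun a => exists v, viscosity_solution H c a v).

End HamiltonJacobi.

Record mesh := Mesh {
  meshN : nat;
  meshK : nat;
  meshN_gt0 : (0 < meshN)%N;
  meshK_gt0 : (0 < meshK)%N
}.

(** Functions on (subsets of) the grid are encoded as total functions of the
    indices m : 'rV[int]_d and k; only the values at indices of the relevant
    parity are ever constrained or used. *)

Section Grid.
Variables (R : realType) (d : nat).
Implicit Types (delta : mesh) (m n : 'rV[int]_d) (k : int).
Implicit Types (w : 'rV[int]_d -> R) (c p : 'rV[R]_d).

Definition hstep delta : R := ((2 * meshN delta)%:R)^-1.
Definition tstep delta : R := ((2 * meshK delta)%:R)^-1.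
Definition mesh_ratio delta : R := tstep delta / hstep delta.

Definition xpt delta m : 'rV[R]_d := hstep delta *: map_mx intr m.
Definition tpt delta k : R := tstep delta * k%:~R.

Definition Geven m : bool := (2 %| \sum_(j < d) m 0 j)%Z.
Definition Godd m : bool := ~~ Geven m.
Definition even_time k : bool := (2 %| k)%Z.

Definition in_grid k m : bool :=
  (Geven m && even_time k) || (Godd m && ~~ even_time k).
Definition in_dual_grid k m : bool :=
  (Godd m && even_time k) || (Geven m && ~~ even_time k).

(* The directions in B: (b, j) stands for e_j if b = false, - e_j if b = true. *)
Definition dir (o : bool * 'I_d) : 'rV[int]_d := (-1) ^+ o.1 *: delta_mx 0 o.2.

Definition Dx delta w m : 'rV[R]_d :=
  \row_j ((w (m + dir (false, j)) - w (m + dir (true, j))) / (2 * hstep delta)).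

(* [Dt delta w' w m] is (D_t v)^{k+1}_m for v^{k+1} = w' and v^k = w. *)
Definition Dt delta w' w m : R :=
  (tstep delta)^-1 * (w' m - (2 * d%:R)^-1 * \sum_o w (m + dir o)).

Definition space_periodic delta w (G : pred 'rV[int]_d) : Prop :=
  forall m j, G m -> w (m + delta_mx 0 j *+ (2 * meshN delta)) = w m.

Definition X delta (r : R) w : Prop :=
  space_periodic delta w Godd /\ (forall m, Geven m -> `|Dx delta w m| <= r).

Variable H : 'rV[R]_d -> R -> 'rV[R]_d -> R.

(* phi^k_delta (v0; c): the equation
   (D_t v)^{k+1}_m + H (x_m, t_k, c + (D_x v)^k_m) = 0 solved for v^{k+1}_m. *)
Fixpoint evol delta c (v0 : 'rV[int]_d -> R) (k : nat) : 'rV[int]_d -> R :=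
  if k is k'.+1 then fun m =>
    (2 * d%:R)^-1 * (\sum_o evol delta c v0 k' (m + dir o))
    - tstep delta *
      H (xpt delta m) (tpt delta k'%:Z) (c + Dx delta (evol delta c v0 k') m)
  else v0.

Definition period_map delta c v0 := evol delta c v0 (2 * meshK delta).

Definition is_discrete_effective_hamiltonian delta r c : R -> Prop :=
  unique (fun a : R => exists2 v0, X delta r v0 &
    forall m, Godd m -> period_map delta c v0 m + a = v0 m).

Record periodic_cell_solution delta (r : R) c (a : R)
    (v : int -> 'rV[int]_d -> R) : Prop := PeriodicCellSolution {
  cell_periodic_x : forall k, space_periodic delta (v k) (in_dual_grid k);
  cell_periodic_t : forall k m, in_dual_grid k m ->
    v (k + (2 * meshK delta)%:Z) m = v k m;
  cell_init : X delta r (v 0);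
  cell_eq : forall k m, in_grid k m ->
    Dt delta (v (k + 1)) (v k) m
    + H (xpt delta m) (tpt delta k) (c + Dx delta (v k) m) = a
}.

Definition grid_error delta (v : int -> 'rV[int]_d -> R)
    (vbar : 'rV[R]_d * R -> R) : R :=
  let idx (m : 'rV['I_(2 * meshN delta)]_d) : 'rV[int]_d :=
    map_mx (fun i : 'I_(2 * meshN delta) => (i : nat)%:Z) m in
  \big[Num.max/0]_(q : 'I_(2 * meshK delta) * 'rV['I_(2 * meshN delta)]_d
                   | in_dual_grid (q.1 : nat)%:Z (idx q.2))
    `|v (q.1 : nat)%:Z (idx q.2)
      - vbar (xpt delta (idx q.2), tpt delta (q.1 : nat)%:Z)|.

End Grid.

Section RandomWalk.
Variables (R : realType) (d : nat).
Variables (delta : mesh) (l : nat).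
Implicit Types (m n : 'rV[int]_d) (xi : nat -> 'rV[int]_d -> 'rV[R]_d).

(* A path of the backward walk started at time t_{l+1} is given by its jumps:
   [s i] is the jump made between the times t_{i+1} and t_i. *)
Definition path_jumps := {ffun 'I_l.+1 -> bool * 'I_d}.
Implicit Types s : path_jumps.

Definition walk n s (k : nat) : 'rV[int]_d :=
  n + \sum_(i < l.+1 | (k <= i)%N) dir (s i).

Definition jump_prob (u : 'rV[R]_d) (o : bool * 'I_d) : R :=
  (2 * d%:R)^-1 - mesh_ratio R delta / 2 * dot (map_mx intr (dir o)) u.

Definition path_prob xi n s : R :=
  \prod_(i < l.+1) jump_prob (xi i.+1 (walk n s i.+1)) (s i).

Definition path_expect xi n (Y : path_jumps -> R) : R :=
  \sum_(s : path_jumps) path_prob xi n s * Y s.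

Definition admissible_control xi : Prop :=
  forall (k : nat) m, (0 < k <= l.+1)%N -> in_dual_grid k%:Z m ->
    `|xi k m| <= (d%:R * mesh_ratio R delta)^-1.

Definition expected_cost (L : 'rV[R]_d -> R -> 'rV[R]_d -> R) (c : 'rV[R]_d)
    (v0 : 'rV[int]_d -> R) n xi : R :=
  path_expect xi n (fun s =>
    \sum_(i < l.+1) tilt L c (xpt R delta (walk n s i.+1)) (tpt R delta (i : nat)%:Z)
                      (xi i.+1 (walk n s i.+1)) * tstep R delta
    + v0 (walk n s 0)).

End RandomWalk.

Section StandingAssumption.
Variables (R : realType) (d : nat).
Implicit Types (L : 'rV[R]_d -> R -> 'rV[R]_d -> R) (w : 'rV[int]_d -> R).

(* H_p (x_m, t_k, c + (D_x v)^k_m) along the solution v with v^0 = w. *)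
Definition velocity L (delta : mesh) (c : 'rV[R]_d) w (k : nat) m : 'rV[R]_d :=
  gradient (hamiltonian L (xpt R delta m) (tpt R delta k%:Z))
    (c + Dx delta (evol (hamiltonian L) delta c w k) m).

Definition optimal_control L delta c w (k : nat) m : 'rV[R]_d :=
  velocity L delta c w k.-1 m.

Record standing_assumption L (P : set 'rV[R]_d) (r lambda1 : R) (delta : mesh) :
    Prop := StandingAssumption {
  standing_invariant : forall c w, P c -> X delta r w ->
    X delta r (period_map (hamiltonian L) delta c w);
  standing_cfl : forall c w (k : nat) m, P c -> X delta r w ->
    in_grid k%:Z m ->
    `|velocity L delta c w k m| <= (d%:R * lambda1)^-1
      /\ (d%:R * lambda1)^-1 < (d%:R * mesh_ratio R delta)^-1;
  standing_representation : forall c w (l : nat) n, P c -> X delta r w ->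
    in_dual_grid l.+1%:Z n ->
    evol (hamiltonian L) delta c w l.+1 n
      = inf [set expected_cost delta l L c w n xi
            | xi in @admissible_control R d delta l];
  standing_minimizer : forall c w (l : nat) n, P c -> X delta r w ->
    in_dual_grid l.+1%:Z n ->
    expected_cost delta l L c w n (optimal_control L delta c w)
      = evol (hamiltonian L) delta c w l.+1 n
}.

End StandingAssumption.

(* Main.v *)
Require Import Defs.
From mathcomp Require Import all_boot all_order all_algebra.
From mathcomp Require Import all_classical all_reals all_analysis.
From mathcomp Require Import ring lra zify.

Import Order.TTheory GRing.Theory Num.Theory.
Import numFieldNormedType.Exports.
Local Open Scope classical_set_scope.
Local Open Scope ring_scope.

Set Implicit Arguments.
Unset Strict Implicit.
Unset Printing Implicit Defensive.

(** Why the theorem holds.  The solutions are equi-Lipschitz and their constants are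
    bounded, so by compactness a subsequence converges uniformly to a periodic
    Lipschitz function, and its constants converge too.  The limit is a viscosity
    solution for the limit constant, and this constant is the effective Hamiltonian
    because only one constant admits a viscosity solution.

    Equi-Lipschitz estimate.  The gradient of the Hamiltonian at p is the unique
    maximizer z of p.z - L, and p is the derivative of L at z
    ([hamiltonian_gradient]).  The velocities are bounded by the CFL condition, hence
    so are the slopes c + D_x v ([cell_slope]).  This does not yet compare values at
    diagonal neighbours m + e_i and m + e_j, because D_x only sees steps of length two
    along one axis.  One step of the scheme, however, averages over the neighbours and
    multiplies the largest diagonal difference by at most 1 - 2/d, up to an error of
    the size of the mesh; a solution bounded for all times therefore has diagonal
    differences of the size of the mesh ([diagonal_recursion], [diagonal_bound]).

    Supersolution.  At each grid point the scheme is an average with nonnegative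
    weights for the optimal velocity, so comparison with a test function at a minimum
    point passes to the limit ([half_limit], [limit_super]).

    Subsolution.  Here one needs the inequality of the scheme for the velocity that is
    optimal for the slope of the test function, and this velocity may violate the CFL
    condition: the set of slopes whose velocity satisfies it need not be convex.  The
    weights are then no longer nonnegative.  But for a fixed velocity the scheme
    inequality is linear and invariant under translations, so it survives averaging
    over q translates in each direction.  The average has second differences of size
    h/q ([slide_gain]), and so the stencil of width one may be replaced by a stencil
    of any fixed odd width J with an error which tends to zero with 1/q
    ([wide_stencil]).  For J large the weights of the wide stencil are nonnegative and
    the comparison argument applies again ([limit_sub]). *)

(** * Calculus and row vectors *)

Lemma nbhs_norm_ball (R : realType) (V : normedModType R) (z : V) (e : R) :
  0 < e -> nbhs z [set z' | `|z' - z| < e].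
Proof. by move=> e0; apply/nbhs_normP; exists e => // y /=; rewrite distrC. Qed.

Lemma continuous_dist (R : realType) (V : normedModType R) (f : V -> R) z0 (e : R) :
  {for z0, continuous f} -> 0 < e ->
  exists2 r, 0 < r & forall z, `|z - z0| <= r -> `|f z - f z0| <= e.
Proof.
move=> cf e0; have /cvgrPdist_le/(_ _ e0)/nbhs_normP[r /= r0 H] := cf.
exists (r / 2) => [|z Hz]; first by rewrite divr_gt0.
by rewrite distrC; apply: H => /=; rewrite distrC; apply: (le_lt_trans Hz); lra.
Qed.

Lemma lipschitz_continuous (R : realType) (V : normedModType R) (g : V -> R) (Lambda : R) :
  0 <= Lambda -> (forall z z', `|g z - g z'| <= Lambda * `|z - z'|) -> continuous g.
Proof.
move=> Lambda0 gL z; apply/cvgrPdist_le => e e0.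
have l0 : 0 < Lambda + 1 by rewrite ltr_wpDl.
have r0 : 0 < e / (Lambda + 1) by rewrite divr_gt0.
apply: filterS (nbhs_norm_ball z r0) => y /= Hy.
apply: (le_trans (gL _ _)).
apply: (@le_trans _ _ ((Lambda + 1) * `|z - y|)); first by rewrite ler_wpM2r// lerDl.
by rewrite mulrC -ler_pdivlMr// distrC ltW.
Qed.

Section LineCalculus.
Context {R : realType} {V : normedModType R}.
Implicit Types (f : V -> R) (x u : V) (s : R).

Lemma is_derive_line f x u s : differentiable f (x + s *: u) ->
  is_derive s 1 (fun a => f (x + a *: u)) ('D_u f (x + s *: u)).
Proof.
move=> /(@diff_derivable _ _ _ _ _ u) df.
have E : (fun h : R => h^-1 *: (((fun a => f (x + a *: u)) \o shift s) (h *: 1)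
            - f (x + s *: u)))
       = (fun h : R => h^-1 *: ((f \o shift (x + s *: u)) (h *: u) - f (x + s *: u))).
  apply/funext => h /=; congr (_ *: (f _ - _)).
  by rewrite [h *: 1]mulr1 scalerDl addrCA.
by split; rewrite /derivable /derive E.
Qed.

Lemma deriveZdir f x u s : differentiable f x -> 'D_(s *: u) f x = s * 'D_u f x.
Proof. by move=> df; rewrite !deriveE// linearZ. Qed.

Lemma mvt_line f x u : (forall y, differentiable f y) ->
  exists2 a, 0 <= a <= 1 & f (x + u) - f x = 'D_u f (x + a *: u).
Proof.
move=> df; pose g a := f (x + a *: u).
have dg (a : R) : is_derive a 1 g ('D_u f (x + a *: u)) by exact: is_derive_line.
have [|a a01] := @MVT_segment R g (fun a => 'D_u f (x + a *: u)) 0 1 ler01 (fun a _ => dg a).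
  apply: continuous_subspaceT => a; apply: differentiable_continuous.
  by apply/derivable1_diffP; case: (dg a).
rewrite /g scale1r scale0r addr0 subr0 mulr1 => ->.
by exists a => //; move: a01; rewrite in_itv.
Qed.

(** The estimate is uniform in the base point z near z0, unlike differentiability at
    z0; the mean value theorem and the continuity of the derivative give it. *)
Lemma C1_strict f z0 u e : C1 f -> 0 < e ->
  exists2 rho, 0 < rho & forall z s, `|z - z0| <= rho -> `|s| <= rho ->
    `|f (z + s *: u) - f z - s * 'D_u f z0| <= e * `|s|.
Proof.
move=> [df cf] e0.
have /cvgrPdist_le/(_ _ e0) := cf u z0.
move=> /nbhs_normP[rho /= rho0 Hr].
have u1 : 0 < 1 + `|u| by rewrite ltr_pwDl.
have r1 : 0 < rho / 3 by rewrite divr_gt0.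
exists (Num.min (rho / 3) (rho / 3 / (1 + `|u|))).
  by rewrite lt_min r1 divr_gt0.
move=> z s; rewrite !le_min => /andP[zz _] /andP[_ su].
have [a /andP[a0 a1] ->] := mvt_line z (s *: u) df.
rewrite deriveZdir// -mulrBr normrM mulrC ler_wpM2r//.
rewrite distrC; apply: Hr => /=.
rewrite opprD addrA.
apply: (@le_lt_trans _ _ (rho / 3 + rho / 3)); last by lra.
rewrite (le_trans (ler_normB _ _))// lerD// 1?distrC//.
rewrite !normrZ (ger0_norm a0) -[leRHS]mul1r ler_pM// ?mulr_ge0//.
rewrite -[leRHS](@divfK _ (1 + `|u|)) ?gt_eqF//.
by rewrite ler_pM// lerDr.
Qed.

End LineCalculus.

Section Vectors.
Context {R : realType} {d : nat}.
Implicit Types (p q z u : 'rV[R]_d).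

Lemma rv_norm_le p (M : R) : 0 <= M -> (forall j, `|p 0 j| <= M) -> `|p| <= M.
Proof.
move=> M0 H; rewrite [leLHS]mx_normrE; apply: bigmax_le => // -[i j] _ /=.
by rewrite (ord1 i).
Qed.

Lemma rv_coord_le p j : `|p 0 j| <= `|p|.
Proof.
rewrite [leRHS]mx_normrE; apply/bigmax_geP; right => /=.
by exists (0, j).
Qed.

Lemma dotDl p q z : dot (p + q) z = dot p z + dot q z.
Proof. by rewrite /dot -big_split; apply: eq_bigr => j _; rewrite mxE mulrDl. Qed.

Lemma dotZl a p z : dot (a *: p) z = a * dot p z.
Proof. by rewrite /dot mulr_sumr; apply: eq_bigr => j _; rewrite mxE mulrA. Qed.

Lemma dotC p q : dot p q = dot q p.
Proof. by apply: eq_bigr => j _; rewrite mulrC. Qed.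

Lemma dotDr p q z : dot z (p + q) = dot z p + dot z q.
Proof. by rewrite dotC dotDl !(dotC z). Qed.

Lemma dotZr a p z : dot z (a *: p) = a * dot z p.
Proof. by rewrite dotC dotZl dotC. Qed.

Lemma dot0l z : dot 0 z = 0.
Proof. by rewrite -[0](scale0r 0) dotZl mul0r. Qed.

Lemma dot_basis j z : dot (basis_vec j) z = z 0 j.
Proof.
rewrite /dot (bigD1 j)//= mxE !eqxx mul1r big1 ?addr0// => i /negbTE ij.
by rewrite mxE eqxx /= ij mul0r.
Qed.

Lemma dot_le p z : `|dot p z| <= d%:R * `|p| * `|z|.
Proof.
apply: le_trans (ler_norm_sum _ _ _) _.
apply: le_trans (ler_sum _ (_ : forall j, _ -> _ <= `|p| * `|z|)) _.
  by move=> j _; rewrite normrM ler_pM// rv_coord_le.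
by rewrite sumr_const card_ord -[leLHS]mulr_natl mulrA.
Qed.

Lemma norm_le_enorm z : `|z| <= enorm z.
Proof.
apply: rv_norm_le => [|j]; first exact: sqrtr_ge0.
rewrite -sqrtr_sqr ler_sqrt ?sumr_ge0//; last by move=> i _; rewrite -expr2 sqr_ge0.
rewrite /dot (bigD1 j)//= -expr2 lerDl sumr_ge0// => i _.
by rewrite -expr2 sqr_ge0.
Qed.

Lemma rv_decomp z : z = \sum_j z 0 j *: basis_vec j.
Proof. by rewrite [LHS]row_sum_delta. Qed.

Lemma dot_differentiable p z : differentiable (fun z => dot p z) z.
Proof.
rewrite /dot.
have -> : (fun z : 'rV[R]_d => \sum_(j < d) p 0 j * z 0 j)
        = \sum_(j < d) (fun z : 'rV[R]_d => p 0 j * z 0 j).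
  by apply/funext => y; rewrite fct_sumE.
apply: differentiable_sum => j.
by apply: differentiableM; [exact: differentiable_cst|exact: differentiable_coord].
Qed.

Lemma closed_ball_rV_compact (r : R) : compact [set z : 'rV[R]_d | `|z| <= r].
Proof.
apply: bounded_closed_compact.
  by exists r; split => [|y ry z /= zr]; [rewrite num_real|rewrite (le_trans zr)// ltW].
have -> : [set z : 'rV[R]_d | `|z| <= r] = Num.norm @^-1` [set y | y <= r] by [].
by apply: closed_comp => [z _|]; [exact: norm_continuous|exact: closed_le].
Qed.

End Vectors.

Lemma basis_vec_le1 (R : realType) d (j : 'I_d) : `|basis_vec j : 'rV[R]_d| <= 1.
Proof.
by apply: rv_norm_le => // i; rewrite mxE eqxx /=; case: eqP; rewrite ?normr1 ?normr0.
Qed.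

Section Periodicity.
Context {R : realType} {d : nat}.

Lemma periodic_shift (T : Type) (f : 'rV[R]_d * R -> T) :
  (forall j y, f (y.1 + basis_vec j, y.2) = f y) ->
  (forall y, f (y.1, y.2 + 1) = f y) ->
  forall (m : 'rV[int]_d) (k : int) x t, f (x + map_mx intr m, t + k%:~R) = f (x, t).
Proof.
move=> Hx Ht m k x t.
have Pn (S : zmodType) (g : S -> T) a (Hg : forall y, g (y + a) = g y) (n : int) y :
    g (y + a *~ n) = g y.
  have P0 i y' : g (y' + a *+ i) = g y'.
    by elim: i y' => [|i IH] y'; rewrite ?addr0// mulrS addrA IH.
  case: n => n; first exact: P0.
  by rewrite -(P0 n.+1) NegzE mulrNz -pmulrn subrK.
rewrite (Pn R (fun t => f (_, t)) 1); last by move=> s; exact: (Ht (_, s)).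
have -> : map_mx intr m = \sum_j basis_vec j *~ m 0 j :> 'rV[R]_d.
  rewrite [LHS]row_sum_delta; apply: eq_bigr => j _.
  by rewrite mxE scaler_int.
apply: (big_ind (fun a => forall x, f (x + a, t) = f (x, t))) => [y|a b Ha Hb y|j _ y].
- by rewrite addr0.
- by rewrite addrA Hb Ha.
- by rewrite (Pn _ (fun x => f (x, t))) // => y'; exact: (Hx j (y', t)).
Qed.

Lemma cell_reduction (x : 'rV[R]_d) (t : R) : exists (m : 'rV[int]_d) (k : int),
  `|x + map_mx intr m| <= 1 /\ `|t + k%:~R| <= 1.
Proof.
have fl (a : R) : `|a + (- Num.floor a)%:~R| <= 1.
  have := floor_le_tmp a; have := floorD1_gt a; rewrite intrD intrN => H1 H2.
  by rewrite ger0_norm; lra.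
exists (\row_j - Num.floor (x 0 j)), (- Num.floor t); split => //.
by apply: rv_norm_le => // j; rewrite !mxE.
Qed.

End Periodicity.

(** * The Legendre transform of a strictly convex superlinear function *)

Section Legendre.
Context {R : realType} {d : nat}.
Variable l : 'rV[R]_d -> R.
Hypothesis dl : forall z, differentiable l z.
Hypothesis ddl : forall u z, differentiable ('D_u l) z.
Hypothesis cvxl : forall z, posdef (hessian l z).
Hypothesis supl : forall a, 0 <= a -> exists b, forall z, a * enorm z + b <= l z.
Implicit Types (p q z u : 'rV[R]_d).

Definition legendre p : R := sup [set dot p z - l z | z in [set: 'rV[R]_d]].

Lemma affine_minorant (a : R) : 0 <= a -> exists b, forall z, a * `|z| + b <= l z.
Proof.
move=> a0; have [b Hb] := supl a0; exists b => z.
by apply: le_trans (Hb z); rewrite lerD2r ler_wpM2l// norm_le_enorm.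
Qed.

Lemma legendre_has_sup p : has_sup [set dot p z - l z | z in [set: 'rV[R]_d]].
Proof.
split; first by exists (dot p 0 - l 0), 0.
have [b Hb] := affine_minorant (mulr_ge0 (ler0n _ d) (normr_ge0 p)).
exists (- b) => _ [z _ <-].
have := dot_le p z; have := Hb z; have := ler_norm (dot p z); lra.
Qed.

Lemma legendre_ge p z : dot p z - l z <= legendre p.
Proof. by apply: ub_le_sup; [case: (legendre_has_sup p)|exists z]. Qed.

Lemma gap_continuous p : continuous (fun z => dot p z - l z).
Proof. move=> z; apply: differentiable_continuous.
apply: (@differentiableB _ _ _ (fun z => dot p z) l); last exact: dl.
exact: dot_differentiable. Qed.

Lemma compact_max (K : set 'rV[R]_d) p : compact K -> K !=set0 ->
  exists2 z, K z & forall y, K y -> dot p y - l y <= dot p z - l z.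
Proof.
move=> cK K0; have [|z] := @compact_EVT_max _ R (fun z => dot p z - l z) K K0 cK.
  by apply: continuous_subspaceT; exact: gap_continuous.
by rewrite inE => Kz Hz; exists z => // y Ky; apply: Hz; rewrite inE.
Qed.

(** Superlinearity with a slope larger than d M: points that do at least as well as
    the origin lie in a ball that depends on p only through M. *)
Lemma near_max_bounded (M : R) : exists2 r : R, 0 < r &
  forall p z, `|p| <= M -> dot p 0 - l 0 <= dot p z - l z -> `|z| <= r.
Proof.
have a0 : 0 <= d%:R * `|M| + 1 :> R by rewrite addr_ge0// mulr_ge0.
have [b Hb] := affine_minorant a0.
exists (`|l 0 - b| + 1) => [|p z pM]; first by rewrite ltr_wpDl.
rewrite dotC dot0l => H.
have := Hb z; have := dot_le p z; have := ler_norm (dot p z).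
have := ler_norm (l 0 - b).
have : d%:R * `|p| * `|z| <= d%:R * `|M| * `|z|.
  by rewrite ler_wpM2r// ler_wpM2l// (le_trans pM) ?ler_norm.
lra.
Qed.

Lemma legendre_attained p : exists z, legendre p = dot p z - l z.
Proof.
have [r r0 Hr] := near_max_bounded `|p|.
have [||z zr Hz] := @compact_max [set z | `|z| <= r] p.
- exact: closed_ball_rV_compact.
- by exists 0; rewrite /= normr0 ltW.
exists z; apply/eqP; rewrite eq_le legendre_ge andbT.
apply: ge_sup; first by case: (legendre_has_sup p).
move=> _ [y _ <-]; have [yr|yr] := leP `|y| r; first exact: Hz.
have [|y0] := leP (dot p 0 - l 0) (dot p y - l y); last first.
  by apply: (le_trans (ltW y0)); apply: Hz; rewrite /= normr0 ltW.
by move=> /(Hr _ _ (lexx _)); rewrite leNgt yr.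
Qed.

Lemma maximizer_critical p z u : legendre p = dot p z - l z -> 'D_u l z = dot p u.
Proof.
move=> Hz; pose g a := dot p (z + a *: u) - l (z + a *: u).
have dg (a : R) : is_derive a 1 g (dot p u - 'D_u l (z + a *: u)).
  have E : g = (cst (dot p z) + (fun a => a * dot p u)) - (fun a => l (z + a *: u)).
    by apply/funext => b; rewrite /g !fctE dotDr dotZr.
  rewrite E; apply: is_deriveB; last exact: is_derive_line.
  rewrite -[X in is_derive _ _ _ X]add0r; apply: is_deriveD.
  have -> : (fun a => a * dot p u) = (dot p u) *: (@id R).
    by apply/funext => b; rewrite fctE /= mulrC.
  rewrite -[X in is_derive _ _ _ X]mulr1; exact: is_deriveZ.
have /@derive_val : is_derive (0 : R) 1 g 0.
  apply: (@derive1_at_max _ g (-1) 1); first lra.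
  - by move=> t _; case: (dg t).
  - by rewrite in_itv /=; lra.
  - by move=> t _; rewrite /g scale0r addr0 -Hz legendre_ge.
rewrite derive_val scale0r addr0 => /eqP; rewrite subr_eq0 => /eqP <- //.
Qed.

Lemma second_derivative u z : 'D_u ('D_u l) z = (u *m hessian l z *m u^T) 0 0.
Proof.
have Du (f : 'rV[R]_d -> R) y : differentiable f y ->
    'D_u f y = \sum_j u 0 j * 'D_(basis_vec j) f y.
  move=> df; rewrite deriveE// {1}(rv_decomp u) linear_sum.
  by apply: eq_bigr => j _; rewrite linearZ deriveE.
rewrite Du//.
have E : 'D_u l = \sum_i (u 0 i *: 'D_(basis_vec i) l).
  apply/funext => y; rewrite Du// fct_sumE.
  by apply: eq_bigr.
rewrite mxE; apply: eq_bigr => j _.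
rewrite [in RHS]mxE mulrC; congr (_ * _); last by rewrite mxE.
rewrite E derive_sum; last by move=> i; apply/derivableZ/diff_derivable.
apply: eq_bigr => i _.
by rewrite deriveZ ?mxE//; exact: diff_derivable.
Qed.

(** Between two maximizers the derivative of l in the direction joining them would
    take the same value at both ends; by Rolle the second derivative would vanish
    somewhere, which positive definiteness excludes. *)
Lemma maximizer_unique p z y :
  legendre p = dot p z - l z -> legendre p = dot p y - l y -> z = y.
Proof.
move=> Hz Hy; apply/eqP/negPn/negP => zy.
pose u := y - z; have u0 : u != 0 by rewrite subr_eq0 eq_sym.
pose g a := 'D_u l (z + a *: u).
have dg (a : R) : is_derive a 1 g ('D_u ('D_u l) (z + a *: u)) by exact: is_derive_line.
have [||||a _ /@derive_val] := @Rolle R g 0 1.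
- exact: ltr01.
- by move=> a _; case: (dg a).
- apply: continuous_subspaceT => a; apply: differentiable_continuous.
  by apply/derivable1_diffP; case: (dg a).
- rewrite /g scale0r scale1r addr0 subrKC.
  by rewrite !(@maximizer_critical p).
rewrite derive_val second_derivative => H0.
by have := @cvxl (z + a *: u) u u0; rewrite H0 ltxx.
Qed.

(** Danskin's argument: for the slope p + s e_j with maximizer y, testing each of the
    two suprema with the maximizer of the other one squeezes the difference quotient
    between z_j and y_j, and y tends to z because z is the only maximizer. *)
Lemma legendre_partial p z j : legendre p = dot p z - l z ->
  'D_(basis_vec j) legendre p = z 0 j.
Proof.
move=> Hz; apply: cvg_lim => //; apply/cvgrPdist_le => e e0.
have [r r0 Hr] := near_max_bounded (`|p| + 1).
(* compactness: off the e-ball around z the function is below its maximum by eta *)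
have [eta eta0 Heta] : exists2 eta : R, 0 < eta &
    forall y, `|y| <= r -> e <= `|y - z| -> dot p y - l y <= legendre p - eta.
  pose K := [set y | `|y| <= r] `&` [set y | e <= `|y - z|].
  have cK : compact K.
    apply: compact_closedI; first exact: closed_ball_rV_compact.
    have -> : [set y | e <= `|y - z|] = (fun y => `|y - z|) @^-1` [set a | e <= a] by [].
    apply: closed_comp => [y _|]; last exact: closed_ge.
    have c1 : continuous (fun y : 'rV[R]_d => y - z).
      move=> y'; apply: differentiable_continuous.
      by [].
    have c2 : continuous (fun y : 'rV[R]_d => `|y - z|).
      by move=> y'; apply: continuous_comp; [exact: c1|exact: norm_continuous].
    exact: c2.
  have [[y Ky]|K0] := pselect (K !=set0); last first.
    by exists 1 => // y yr yz; exfalso; apply: K0; exists y.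
  have [y0 [y0r y0z] Hy0] := compact_max p cK (ex_intro _ y Ky).
  exists (legendre p - (dot p y0 - l y0)); last by move=> w wr wz; rewrite subKr; exact: Hy0.
  rewrite subr_gt0 lt_neqAle legendre_ge andbT; apply/eqP => Heq.
  have zy := maximizer_unique Hz (esym Heq).
  by move: y0z; rewrite /= zy subrr normr0 leNgt e0.
pose s0 := Num.min 1 (eta / (r + `|z 0 j| + 1)).
have den : 0 < r + `|z 0 j| + 1 by rewrite ltr_wpDl// addr_ge0// ltW.
have s00 : 0 < s0 by rewrite lt_min ltr01 divr_gt0.
near=> s.
have s_neq0 : s != 0 by near: s; exact: nbhs_dnbhs_neq.
have ss0 : `|s| < s0.
  near: s; apply: dnbhs0_lt => //.
have [y Hy] := legendre_attained (p + s *: basis_vec j).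
have yr : `|y| <= r.
  apply: (Hr (p + s *: basis_vec j)); last by rewrite -Hy legendre_ge.
  rewrite (le_trans (ler_normD _ _))// lerD2l normrZ.
  rewrite -[1]mulr1 ler_pM ?basis_vec_le1//.
  by move: ss0; rewrite lt_min => /andP[/ltW].
rewrite /= [s *: _ + p]addrC -[_ *: (legendre _ - _)]/(s^-1 * _).
have lo := legendre_ge (p + s *: basis_vec j) z.
have hi := legendre_ge p y.
move: Hy lo; rewrite !dotDl !dotZl !dot_basis => Hy lo.
(* if y were off the e-ball, the loss eta would exceed the gain of order s *)
have yz : `|y - z| <= e.
  rewrite leNgt; apply/negP => /ltW /(Heta _ yr) Hgap.
  have : `|s| * (r + `|z 0 j| + 1) < eta.
    rewrite -ltr_pdivlMr//.
    by move: ss0; rewrite lt_min => /andP[].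
  have := ler_norm (s * y 0 j); have := ler_norm (- (s * z 0 j)).
  rewrite normrN !normrM.
  have : `|s| * `|y 0 j| <= `|s| * r by rewrite ler_wpM2l// (le_trans (rv_coord_le _ _)).
  have := normr_ge0 s; nra.
have yzj : `|y 0 j - z 0 j| <= e.
  by apply: le_trans yz; have := rv_coord_le (y - z) j; rewrite !mxE.
have A : 0 <= legendre (p + s *: basis_vec j) - legendre p - s * z 0 j by lra.
have B : legendre (p + s *: basis_vec j) - legendre p - s * z 0 j <= s * (y 0 j - z 0 j) by lra.
rewrite distrC -[z 0 j](mulKf s_neq0) -mulrBr normrM normfV ler_pdivrMl ?normr_gt0//.
rewrite ger0_norm// (le_trans B)// (le_trans (ler_norm _))// normrM.
by rewrite ler_wpM2l.
Unshelve. all: by end_near.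
Qed.

(** Duality of the two gradients: the second part recovers the slope p from the
    velocity z. *)
Lemma legendre_gradient p : let z := gradient legendre p in
  legendre p = dot p z - l z /\ forall u, 'D_u l z = dot p u.
Proof.
have [z Hz] := legendre_attained p.
have -> : gradient legendre p = z by apply/rowP => j; rewrite mxE (legendre_partial _ Hz).
by split => // u; apply: maximizer_critical.
Qed.

End Legendre.

(** * Uniform bounds for the Lagrangian and the Hamiltonian *)

Section Lagrangian.
Context {R : realType} {d : nat}.
Variable L : 'rV[R]_d -> R -> 'rV[R]_d -> R.
Hypothesis HL : lagrangian L.
Implicit Types (x p z u : 'rV[R]_d) (t : R).

Let F (y : 'rV[R]_d * R * 'rV[R]_d) : R := L y.1.1 y.1.2 y.2.
Let C2F : C2 F. Proof. exact: lagr_C2 HL. Qed.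

Lemma fibre_embedding_differentiable x t z :
  differentiable (fun z' : 'rV[R]_d => ((x, t), z')) z.
Proof. by apply: differentiable_pair => //; exact: differentiable_cst. Qed.

Lemma fibre_derive x t z u : 'D_u (L x t) z = 'D_((0, 0), u) F ((x, t), z).
Proof.
rewrite /derive.
suff -> : (fun h : R => h^-1 *: ((L x t \o shift z) (h *: u) - L x t z))
  = (fun h => h^-1 *: ((F \o shift ((x, t), z)) (h *: ((0, 0), u)) - F ((x, t), z))) by [].
apply/funext => h /=; congr (h^-1 *: (_ - _)).
by rewrite /F /= !scaler0 !add0r.
Qed.

Lemma fibre_differentiable x t z : differentiable (L x t) z.
Proof.
apply: (@differentiable_comp _ _ _ _ (fun z' => ((x, t), z')) F).
  exact: fibre_embedding_differentiable.
exact: (C2F.1).1.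
Qed.

Lemma fibre_differentiable2 x t u z : differentiable ('D_u (L x t)) z.
Proof.
have -> : 'D_u (L x t) = 'D_((0, 0), u) F \o (fun z' => ((x, t), z')).
  by apply/funext => z' /=; rewrite fibre_derive.
apply: differentiable_comp; first exact: fibre_embedding_differentiable.
exact: (C2F.2 _).1.
Qed.

Lemma fibre_superlinear x t (a : R) : 0 <= a ->
  exists b, forall z, a * enorm z + b <= L x t z.
Proof. by move=> /(lagr_superlinear HL)[b Hb]; exists b. Qed.

Lemma hamiltonian_ge x t p z : dot p z - L x t z <= hamiltonian L x t p.
Proof.
apply: legendre_ge; exact: fibre_superlinear.
Qed.

Lemma hamiltonian_gradient x t p : let z := gradient (hamiltonian L x t) p in
  hamiltonian L x t p = dot p z - L x t z /\ forall u, 'D_u (L x t) z = dot p u.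
Proof.
apply: legendre_gradient; [exact: fibre_differentiable|exact: fibre_differentiable2|
  exact: lagr_convex HL _ _|exact: fibre_superlinear].
Qed.

Lemma L_shift (m : 'rV[int]_d) (k : int) x t :
  L (x + map_mx intr m) (t + k%:~R) = L x t.
Proof.
apply: (@periodic_shift _ _ _ (fun y => L y.1 y.2)) => /= [j y|y];
  apply/funext => z; [exact: lagr_periodic_x HL _ _ _ _|exact: lagr_periodic_t HL _ _ _].
Qed.

Lemma hamiltonian_shift (m : 'rV[int]_d) (k : int) x t :
  hamiltonian L (x + map_mx intr m) (t + k%:~R) = hamiltonian L x t.
Proof. by apply/funext => p; rewrite /hamiltonian L_shift. Qed.

Lemma unit_cell x t : exists x' t', [/\ `|x'| <= 1, `|t'| <= 1 & L x t = L x' t'].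
Proof.
have [m [k [H1 H2]]] := cell_reduction x t.
by exists (x + map_mx intr m), (t + k%:~R); rewrite L_shift.
Qed.

Lemma bounded_on_cell (G : 'rV[R]_d * R * 'rV[R]_d -> R) (Q : R) : continuous G ->
  exists2 C, 0 < C & forall x t z, `|x| <= 1 -> `|t| <= 1 -> `|z| <= Q ->
    `|G ((x, t), z)| <= C.
Proof.
move=> cG.
pose K := ([set x : 'rV[R]_d | `|x| <= 1] `*` [set t : R | `|t| <= 1])
            `*` [set z : 'rV[R]_d | `|z| <= Q].
have cK : compact K.
  apply: compact_setX; last exact: closed_ball_rV_compact.
  apply: compact_setX; first exact: closed_ball_rV_compact.
  have -> : [set t : R | `|t| <= 1] = `[-1, 1]%classic.
    by apply/seteqP; split => t /=; rewrite in_itv /= ler_norml.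
  exact: segment_compact.
have /ex_strict_bound_gt0[C C0 HC] : bounded_set (G @` K).
  apply: compact_bounded; apply: continuous_compact => //.
  exact: continuous_subspaceT.
exists C => // x t z Hx Ht Hz; apply/ltW/HC.
by exists ((x, t), z).
Qed.

Lemma L_continuous : continuous F.
Proof. by move=> y; apply/differentiable_continuous/(C2F.1).1. Qed.

Lemma L_bound (Q : R) : exists2 C, 0 < C &
  forall x t z, `|z| <= Q -> `|L x t z| <= C.
Proof.
have [C C0 HC] := bounded_on_cell Q L_continuous.
exists C => // x t z zQ; have [x' [t' [x1 t1 ->]]] := unit_cell x t.
exact: (HC x' t' z).
Qed.

(** The slope dual to a velocity is a derivative of L at that velocity, hence bounded
    on bounded sets of velocities. *)
Lemma slope_bound (Q : R) : exists2 C, 0 < C & forall x t z p, `|z| <= Q ->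
  (forall u, 'D_u (L x t) z = dot p u) -> `|p| <= C.
Proof.
have /choice[C HC] (j : 'I_d) : exists C, 0 < C /\
    forall x t z, `|x| <= 1 -> `|t| <= 1 -> `|z| <= Q ->
    `|'D_((0, 0), basis_vec j) F ((x, t), z)| <= C.
  by have [C] := bounded_on_cell Q (C2F.1.2 ((0, 0), basis_vec j)); exists C.
have S0 : 0 <= \sum_j C j by apply: sumr_ge0 => j _; apply/ltW/(HC j).1.
exists (\sum_j C j + 1); first by rewrite ltr_wpDl.
move=> x t z p zQ Hp; apply: rv_norm_le => [|j]; first by rewrite addr_ge0.
have [x' [t' [x1 t1 E]]] := unit_cell x t.
apply: (@le_trans _ _ (C j)); last first.
  rewrite (bigD1 j)//= -addrA lerDl addr_ge0// sumr_ge0// => i _.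
  exact/ltW/(HC i).1.
have -> : p 0 j = 'D_((0, 0), basis_vec j) F ((x', t'), z).
  by rewrite -fibre_derive -E Hp dotC dot_basis.
exact: (HC j).2.
Qed.

Lemma hamiltonian_bound (M : R) : exists2 C, 0 < C &
  forall x t p, `|p| <= M -> `|hamiltonian L x t p| <= C.
Proof.
have [C C0 HC] := L_bound 0.
have a0 : 0 <= d%:R * `|M| by rewrite mulr_ge0.
have [b Hb] := lagr_superlinear HL a0.
exists (C + `|b|) => [|x t p pM]; first by rewrite ltr_pwDl.
have lo := hamiltonian_ge x t p 0.
have [hi _] := hamiltonian_gradient x t p.
set z := gradient _ _ in hi.
have H1 := HC x t 0; rewrite normr0 lexx in H1; have {}H1 := H1 isT.
rewrite dotC dot0l in lo.
have H2 := Hb x t z; have H3 := dot_le p z.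
have H4 : d%:R * `|p| * `|z| <= d%:R * `|M| * enorm z.
  by rewrite ler_pM ?mulr_ge0// ?norm_le_enorm// ler_wpM2l// (le_trans pM)// ler_norm.
have H5 := ler_norm (dot p z); have H6 := ler_norm (- b); rewrite normrN in H6.
have H7 := ler_norm (L x t 0); have H8 := normr_ge0 b.
by rewrite ler_norml; apply/andP; split; lra.
Qed.

Lemma L_equicontinuous (Q e : R) x0 t0 : 0 < e ->
  exists2 rho, 0 < rho & forall x t z, `|x - x0| <= rho -> `|t - t0| <= rho ->
    `|z| <= Q -> `|L x t z - L x0 t0 z| <= e.
Proof.
move=> e0; have e2 : 0 < e / 2 by rewrite divr_gt0.
have /compact_near_coveringP cov := @closed_ball_rV_compact R d Q.
pose P (y : 'rV[R]_d * R) z := `|F (y, z) - F ((x0, t0), z)| <= e.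
have step z : `|z| <= Q -> \forall z' \near z & y \near (x0, t0), P y z'.
  move=> zQ.
  have /cvgrPdist_le/(_ _ e2)[[A B] /= [nA nB] AB] := @L_continuous ((x0, t0), z).
  exists (B, A); first by split.
  move=> [z' y] /= [Bz Ay].
  have H1 := AB (y, z') (conj Ay Bz).
  have H2 := AB ((x0, t0), z') (conj (nbhs_singleton nA) Bz).
  rewrite /P (splitr e) -(subrKA (F ((x0, t0), z))) (le_trans (ler_normD _ _))// lerD//.
  by rewrite distrC.
have := cov _ (nbhs (x0, t0)) P (nbhs_filter _) step.
move=> /nbhs_normP[rho /= rho0 H].
exists (rho / 2) => [|x t z Hx Ht Hz]; first by rewrite divr_gt0.
apply: (H (x, t)) => //=.
by rewrite prod_normE /= gt_max !(distrC _ x, distrC _ t); apply/andP; split; lra.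
Qed.

End Lagrangian.

(** * Parity on the index lattice *)

Section Lattice.
Context {d : nat}.
Implicit Types (m n : 'rV[int]_d) (k : int).

Definition unit_step (j : 'I_d) : 'rV[int]_d := delta_mx 0 j.

Lemma dir_false j : dir (false, j) = unit_step j.
Proof. by rewrite /dir /= expr0 scale1r. Qed.

Lemma dir_true j : dir (true, j) = - unit_step j.
Proof. by rewrite /dir /= expr1 scaleN1r. Qed.

Lemma sum_dir (R : realType) (F : bool * 'I_d -> R) :
  \sum_o F o = \sum_j (F (false, j) + F (true, j)).
Proof.
have -> : \sum_o F o = \sum_b \sum_j F (b, j).
  by rewrite (pair_bigA _ (fun b j => F (b, j))); apply: eq_bigr => -[].
rewrite exchange_big /=.
by apply: eq_bigr => j _; rewrite big_bool addrC.
Qed.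

Definition coord_sum m : int := \sum_j m 0 j.

Lemma coord_sumD m n : coord_sum (m + n) = coord_sum m + coord_sum n.
Proof. by rewrite /coord_sum -big_split; apply: eq_bigr => j _; rewrite mxE. Qed.

Lemma coord_sumN m : coord_sum (- m) = - coord_sum m.
Proof. by rewrite /coord_sum -sumrN; apply: eq_bigr => j _; rewrite mxE. Qed.

Lemma coord_sumMn m i : coord_sum (m *+ i) = coord_sum m *+ i.
Proof. by elim: i => [|i IH]; rewrite ?mulrS ?coord_sumD ?IH// /coord_sum big1// => j; rewrite mxE. Qed.

Lemma coord_sum_unit j : coord_sum (unit_step j) = 1.
Proof.
rewrite /coord_sum (bigD1 j)//= mxE !eqxx big1 ?addr0// => i /negbTE ij.
by rewrite mxE ij andbF.
Qed.

Lemma in_gridE k m : in_grid k m = (2 %| coord_sum m + k)%Z.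
Proof. by rewrite /in_grid /Godd /Geven /even_time -/(coord_sum m); lia. Qed.

Lemma in_dual_gridE k m : in_dual_grid k m = ~~ (2 %| coord_sum m + k)%Z.
Proof. by rewrite /in_dual_grid /Godd /Geven /even_time -/(coord_sum m); lia. Qed.

Let parityE :=
  (in_gridE, in_dual_gridE, coord_sumD, coord_sumN, coord_sumMn, coord_sum_unit).

Lemma in_grid_stepD k m j : in_grid k (m + unit_step j) = in_dual_grid k m.
Proof. by rewrite !parityE; lia. Qed.

Lemma in_grid_stepB k m j : in_grid k (m - unit_step j) = in_dual_grid k m.
Proof. by rewrite !parityE; lia. Qed.

Lemma in_dual_grid_stepD k m j : in_dual_grid k (m + unit_step j) = in_grid k m.
Proof. by rewrite !parityE; lia. Qed.

Lemma in_dual_grid_stepB k m j : in_dual_grid k (m - unit_step j) = in_grid k m.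
Proof. by rewrite !parityE; lia. Qed.

Lemma in_grid_next k m : in_grid (k + 1) m = in_dual_grid k m.
Proof. by rewrite !parityE; lia. Qed.

Lemma in_dual_grid_next k m : in_dual_grid (k + 1) m = in_grid k m.
Proof. by rewrite !parityE; lia. Qed.

Lemma in_dual_grid_prev k m : in_dual_grid (k - 1) m = in_grid k m.
Proof. by rewrite !parityE; lia. Qed.

Lemma in_grid_prev k m : in_grid (k - 1) m = in_dual_grid k m.
Proof. by rewrite !parityE; lia. Qed.

Lemma in_grid_dir k m o : in_grid k (m + dir o) = in_dual_grid k m.
Proof. by case: o => -[] j; rewrite ?dir_true ?dir_false (in_grid_stepD, in_grid_stepB). Qed.

Lemma in_dual_grid_dir k m o : in_dual_grid k (m + dir o) = in_grid k m.
Proof. by case: o => -[] j; rewrite ?dir_true ?dir_false (in_dual_grid_stepD, in_dual_grid_stepB). Qed.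

(** Rewriting with this rule moves any parity statement about a neighbour back to the
    base point. *)
Definition stepE := (in_grid_stepD, in_grid_stepB, in_dual_grid_stepD, in_dual_grid_stepB,
  in_grid_next, in_dual_grid_next, in_grid_prev, in_dual_grid_prev, in_grid_dir, in_dual_grid_dir).

Lemma dualN k m : in_dual_grid k m = ~~ in_grid k m.
Proof. by rewrite !parityE. Qed.

Lemma in_dual_grid_period_x k m j i : in_dual_grid k (m + unit_step j *+ (2 * i)) = in_dual_grid k m.
Proof. by rewrite !parityE; lia. Qed.

Lemma in_grid_period_x k m j a : in_grid k (m + unit_step j *+ (2 * a)) = in_grid k m.
Proof. by apply: negb_inj; rewrite -!dualN in_dual_grid_period_x. Qed.

Lemma in_dual_grid_period_t k m i : in_dual_grid (k + (2 * i)%N%:Z) m = in_dual_grid k m.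
Proof. by rewrite !parityE; lia. Qed.

Lemma in_grid_period_t k m i : in_grid (k + (2 * i)%N%:Z) m = in_grid k m.
Proof. by rewrite !parityE; lia. Qed.

Lemma in_dual_grid_wide k m o i : in_dual_grid k (m + dir o *+ (2 * i + 1)) = in_grid k m.
Proof. by case: o => -[] j; rewrite ?dir_true ?dir_false !parityE; lia. Qed.

Lemma in_dual_grid_odd k m j (i : int) :
  in_dual_grid k (m + unit_step j *~ (2 * i + 1)) = in_grid k m.
Proof.
have E : coord_sum (unit_step j *~ (2 * i + 1)) = 2 * i + 1.
  have Ez (a : int) : coord_sum (unit_step j *~ a) = a.
    by case: a => a; rewrite ?NegzE ?mulrNz -?pmulrn ?coord_sumN coord_sumMn coord_sum_unit natz.
  exact: Ez.
by rewrite !parityE E; lia.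
Qed.

Lemma in_grid0 k : in_grid k (0 : 'rV[int]_d) = (2 %| k)%Z.
Proof. by rewrite parityE /coord_sum big1 ?add0r// => j; rewrite mxE. Qed.

End Lattice.

(** * The scheme as an average over neighbours *)

Section GridFunctions.
Context {R : realType} {d : nat}.
Variable delta : mesh.
Implicit Types (m n : 'rV[int]_d) (k : int) (w : 'rV[int]_d -> R).

Let h := hstep R delta.
Let tau := tstep R delta.

Lemma hstep_gt0 : 0 < h.
Proof. by rewrite invr_gt0 ltr0n muln_gt0 meshN_gt0. Qed.

Lemma tstep_gt0 : 0 < tau.
Proof. by rewrite invr_gt0 ltr0n muln_gt0 meshK_gt0. Qed.

Lemma mesh_ratioE : mesh_ratio R delta * h = tau.
Proof. by rewrite /mesh_ratio divfK// gt_eqF// hstep_gt0. Qed.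

Definition neighbour_mean w m : R := (2 * d%:R)^-1 * \sum_o w (m + dir o).

Lemma dot_dir (u : 'rV[R]_d) b j :
  dot (map_mx intr (dir (b, j))) u = (-1) ^+ b * u 0 j.
Proof.
have -> : map_mx intr (dir (b, j)) = (-1) ^+ b *: basis_vec j :> 'rV[R]_d.
  apply/rowP => i; rewrite !mxE.
  by case: b; rewrite ?expr1 ?expr0 ?mulN1r ?mul1r ?mulrNz; case: (_ && _).
by rewrite dotZl dot_basis.
Qed.

(** The drift of the walk produces exactly the centred difference [Dx]; this turns the
    scheme into a control problem. *)
Lemma jump_mean w m u :
  \sum_o jump_prob delta u o * w (m + dir o)
    = neighbour_mean w m - tau * dot (Dx delta w m) u.
Proof.
rewrite /neighbour_mean /jump_prob.
under eq_bigr do rewrite mulrBl.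
rewrite sumrB -mulr_sumr; congr (_ - _).
rewrite sum_dir {3}/dot mulr_sumr; apply: eq_bigr => j _.
rewrite !dot_dir mxE -mesh_ratioE -/h !dir_false !dir_true.
by field; rewrite gt_eqF ?hstep_gt0.
Qed.

(** The weights have total mass one and mean displacement - tau u: they average an
    affine function exactly. *)
Lemma jump_prob_affine (u : 'rV[R]_d) (a0 : R) (a : 'I_d -> R) : (0 < d)%N ->
  \sum_o jump_prob delta u o * (a0 + (-1) ^+ o.1 * a o.2)
    = a0 - mesh_ratio R delta * \sum_j u 0 j * a j.
Proof.
move=> d_gt0; rewrite sum_dir mulr_sumr /jump_prob.
have d0' : 0 < d%:R :> R by rewrite ltr0n.
have {3}-> : a0 = \sum_(j < d) (d%:R^-1 * a0).
  by rewrite sumr_const card_ord -[RHS]mulr_natl mulVKf// gt_eqF.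
rewrite -sumrB; apply: eq_bigr => j _.
rewrite !dot_dir /= expr0 expr1; field.
by rewrite gt_eqF.
Qed.

Lemma jump_prob_ge0 (u : 'rV[R]_d) o : (0 < d)%N -> 0 < mesh_ratio R delta ->
  `|u| <= (d%:R * mesh_ratio R delta)^-1 -> 0 <= jump_prob delta u o.
Proof.
move=> d0 l0 Hu; case: o => b j; rewrite /jump_prob dot_dir subr_ge0.
have d0' : 0 < d%:R :> R by rewrite ltr0n.
have H1 : (-1) ^+ b * u 0 j <= (d%:R * mesh_ratio R delta)^-1.
  apply: le_trans (ler_norm _) _; rewrite normrM normr_sign mul1r.
  exact: le_trans (rv_coord_le _ _) Hu.
apply: (@le_trans _ _ (mesh_ratio R delta / 2 * (d%:R * mesh_ratio R delta)^-1)).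
  by rewrite ler_wpM2l// divr_ge0// ltW.
rewrite le_eqVlt; apply/orP; left; apply/eqP; field.
by rewrite !gt_eqF.
Qed.

Lemma neighbour_mean_le w m (a : R) : (0 < d)%N ->
  (forall o, w (m + dir o) <= a) -> neighbour_mean w m <= a.
Proof.
move=> d0 H; have d0' : 0 < d%:R :> R by rewrite ltr0n.
rewrite /neighbour_mean ler_pdivrMl ?mulr_gt0//.
apply: (le_trans (ler_sum _ (fun o _ => H o))).
by rewrite sumr_const card_prod card_bool card_ord -[leLHS]mulr_natl natrM mulrC.
Qed.

Lemma neighbour_meanN w m : neighbour_mean (fun m => - w m) m = - neighbour_mean w m.
Proof. by rewrite /neighbour_mean sumrN mulrN. Qed.

Lemma neighbour_mean_close w m (a b : R) : (0 < d)%N ->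
  (forall o, `|w (m + dir o) - a| <= b) -> `|neighbour_mean w m - a| <= b.
Proof.
move=> d0 H; rewrite ler_norml lerBrDl lerBlDl; apply/andP; split.
  suff : neighbour_mean (fun m => - w m) m <= b - a by rewrite neighbour_meanN; lra.
  by apply: neighbour_mean_le => // o; have := H o; rewrite ler_norml => /andP[]; lra.
suff : neighbour_mean w m <= b + a by lra.
by apply: neighbour_mean_le => // o; have := H o; rewrite ler_norml => /andP[]; lra.
Qed.

Lemma DtE w' w m : Dt delta w' w m = tau^-1 * (w' m - neighbour_mean w m).
Proof. by []. Qed.

End GridFunctions.

(** * Lipschitz estimates on the dual grid *)

Section Bounds.
Context {R : realType} {d : nat}.
Variable delta : mesh.
Hypothesis d_gt0 : (0 < d)%N.
Let h := hstep R delta.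
Let tau := tstep R delta.
Implicit Types (m n : 'rV[int]_d) (k : int).

Lemma dual_point : exists k m, @in_dual_grid d k m.
Proof. by exists 1, 0; rewrite dualN in_grid0. Qed.

(** A function dominated by the averages of its past minus a fixed rate would have a
    supremum that decreases in time, but the supremum is taken over all times. *)
Lemma subsolution_rate (u : int -> 'rV[int]_d -> R) (M b : R) :
  (forall k m, in_dual_grid k m -> `|u k m| <= M) ->
  (forall k m, in_grid k m -> u (k + 1) m <= neighbour_mean (u k) m + tau * b) ->
  0 <= b.
Proof.
move=> uM Hu; rewrite leNgt; apply/negP => b0.
pose S := [set a | exists k m, in_dual_grid k m /\ a = u k m].
have supS : has_sup S.
  split; first by have [k [m km]] := dual_point; exists (u k m), k, m.
  exists M => _ [k [m [km ->]]]; exact: le_trans (ler_norm _) (uM _ _ km).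
have e0 : 0 < tau * - b by rewrite mulr_gt0 ?tstep_gt0 ?oppr_gt0.
have [_ [k [m [km ->]]] Hkm] := sup_adherent e0 supS.
have gk : in_grid (k - 1) m by rewrite stepE.
have := Hu _ _ gk; rewrite subrK.
have : neighbour_mean (u (k - 1)) m <= sup S.
  apply: neighbour_mean_le => // -[ob oj]; apply: ub_le_sup; first exact: supS.2.
  by exists (k - 1), (m + dir (ob, oj)); rewrite !stepE.
lra.
Qed.

Variables (v : int -> 'rV[int]_d -> R) (M C CH a : R).
Hypothesis C0 : 0 <= C.
Hypothesis vM : forall k m, in_dual_grid k m -> `|v k m| <= M.
Hypothesis vDx : forall k m j, in_grid k m ->
  `|v k (m + unit_step j) - v k (m - unit_step j)| <= 2 * h * C.
Hypothesis vDt : forall k m, in_grid k m ->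
  `|v (k + 1) m - neighbour_mean (v k) m - tau * a| <= tau * CH.

Lemma rate_bound : `|a| <= CH.
Proof.
have tau0 : 0 < tau := tstep_gt0 delta.
rewrite ler_norml lerNl -subr_ge0 -[_ && _]andbC -subr_ge0; apply/andP; split.
  apply: (@subsolution_rate (fun k m => - v k m) M).
    by move=> k m km; rewrite normrN vM.
  move=> k m km; rewrite neighbour_meanN.
  by have := vDt km; rewrite ler_norml => /andP[]; lra.
apply: (@subsolution_rate v M) => // k m km.
by have := vDt km; rewrite ler_norml => /andP[]; lra.
Qed.

Lemma time_step_bound k m : in_grid k m ->
  `|v (k + 1) m - neighbour_mean (v k) m| <= 2 * CH * tau.
Proof.
move=> km; have tau0 : 0 < tau := tstep_gt0 delta.
have := vDt km; have := rate_bound; rewrite !ler_norml => /andP[A B] /andP[C' D].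
have : tau * a <= tau * CH by rewrite ler_pM2l.
have : tau * - CH <= tau * a by rewrite ler_pM2l.
by move=> *; apply/andP; split; lra.
Qed.

Let h0 : 0 < h := hstep_gt0 delta.
Let tau0 : 0 < tau := tstep_gt0 delta.
Let CH0 : 0 <= CH := le_trans (normr_ge0 a) rate_bound.

Let diag k m i j := v k (m + unit_step i) - v k (m + unit_step j).

(** The difference at time k + 1 averages, over the directions b, the diagonal
    differences at m + e_b and m - e_b.  For b = i and b = j these combine into steps of
    length two along the axes, which [vDx] controls; only d - 2 of the d terms are
    bounded by D. *)
Lemma diagonal_recursion (D : R) k m i j : in_grid (k + 1) m -> i != j ->
  (forall k m i j, in_grid k m -> `|diag k m i j| <= D) ->
  `|diag (k + 1) m i j| <= (d%:R - 2) / d%:R * D + (4 * h * C / d%:R + 4 * CH * tau).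
Proof.
move=> km ij HD.
have ji : j != i by rewrite eq_sym.
have d0' : 0 < d%:R :> R by rewrite ltr0n.
move: km; rewrite stepE => km.
have gi : in_grid k (m + unit_step i) by rewrite stepE.
have gj : in_grid k (m + unit_step j) by rewrite stepE.
have Ti := time_step_bound gi; have Tj := time_step_bound gj.
pose A b := (v k (m + unit_step i + unit_step b) + v k (m + unit_step i - unit_step b))
          - (v k (m + unit_step j + unit_step b) + v k (m + unit_step j - unit_step b)).
have EA : neighbour_mean (v k) (m + unit_step i) - neighbour_mean (v k) (m + unit_step j)
          = (2 * d%:R)^-1 * \sum_b A b.
  rewrite /neighbour_mean -mulrBr !sum_dir -sumrB; congr (_ * _).
  by apply: eq_bigr => b _; rewrite !dir_false !dir_true.
have Arest : `|\sum_(b | (b != i) && (b != j)) A b| <= 2 * d%:R * D - 4 * D.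
  apply: (@le_trans _ _ (\sum_(b < d | (b != i) && (b != j)) (2 * D))).
    apply: (le_trans (ler_norm_sum _ _ _)); apply: ler_sum => b _.
    have -> : A b = diag k (m + unit_step b) i j + diag k (m - unit_step b) i j.
      rewrite /A /diag ![m + unit_step b + _]addrAC ![m - unit_step b + _]addrAC.
      by ring.
    apply: (le_trans (ler_normD _ _)).
    by rewrite mulr_natl mulr2n lerD// HD// stepE.
  have -> : 2 * d%:R * D = \sum_(b < d) (2 * D).
    by rewrite sumr_const card_ord -[RHS]mulr_natl; ring.
  by rewrite [in leRHS](bigD1 i)//= [in leRHS](bigD1 j)//=; lra.
have Aij : `|A i + A j| <= 8 * h * C.
  have -> : A i + A j
     = (v k (m + unit_step i + unit_step i) - v k (m + unit_step i - unit_step i))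
     - (v k (m + unit_step j + unit_step j) - v k (m + unit_step j - unit_step j))
     + ((v k (m + unit_step j + unit_step i) - v k (m + unit_step j - unit_step i))
       - (v k (m + unit_step i + unit_step j) - v k (m + unit_step i - unit_step j)))
     + (v k (m + unit_step i + unit_step j) - v k (m + unit_step j + unit_step i)) *+ 2
     + (v k (m + unit_step i - unit_step i) - v k (m + unit_step j - unit_step j)) *+ 2.
    by rewrite /A; ring.
  rewrite !addrK [m + unit_step j + unit_step i]addrAC !subrr !mul0rn !addr0.
  have := vDx i gi; have := vDx j gj; have := vDx i gj; have := vDx j gi.
  rewrite !addrK [m + unit_step j + unit_step i]addrAC.
  rewrite !ler_norml => /andP[? ?] /andP[? ?] /andP[? ?] /andP[? ?].
  by apply/andP; split; lra.
have EB : `|neighbour_mean (v k) (m + unit_step i) - neighbour_mean (v k) (m + unit_step j)|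
          <= (d%:R - 2) / d%:R * D + 4 * h * C / d%:R.
  rewrite EA (bigD1 i)//= (bigD1 j)//= addrA normrM ger0_norm; last first.
    by rewrite invr_ge0 mulr_ge0// ltW.
  rewrite ler_pdivrMl ?mulr_gt0//.
  have -> : 2 * d%:R * ((d%:R - 2) / d%:R * D + 4 * h * C / d%:R)
     = 8 * h * C + (2 * d%:R * D - 4 * D).
    by field; rewrite gt_eqF.
  by apply: (le_trans (ler_normD _ _)); exact: lerD.
rewrite /diag; move: Ti Tj EB; rewrite !ler_norml.
by move=> /andP[? ?] /andP[? ?] /andP[? ?]; apply/andP; split; lra.
Qed.

(** The supremum D of all diagonal differences is finite and satisfies the recursion
    with factor 1 - 2/d < 1. *)
Lemma diagonal_bound k m i j : in_grid k m ->
  `|v k (m + unit_step i) - v k (m + unit_step j)| <= 2 * h * C + 2 * d%:R * CH * tau.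
Proof.
move=> km; rewrite -/(diag k m i j).
have d0' : 0 < d%:R :> R by rewrite ltr0n.
have M0 : 0 <= M by have [k' [m' /vM]] := dual_point; exact: le_trans.
pose S := [set a | exists k m i j, in_grid k m /\ a = `|diag k m i j|].
have Sk : S (`|diag k m i j|) by exists k, m, i, j.
have supS : has_sup S.
  split; first by exists (`|diag k m i j|).
  exists (M + M) => _ [k' [m' [i' [j' [km' ->]]]]].
  apply: (le_trans (ler_normB _ _)).
  by rewrite lerD// vM// stepE.
have HD k' m' i' j' : in_grid k' m' -> `|diag k' m' i' j'| <= sup S.
  by move=> km'; apply: ub_le_sup; [exact: supS.2|exists k', m', i', j'].
apply: (le_trans (HD _ _ _ _ km)).
set B := 2 * h * C + _; set K := 4 * h * C / d%:R + 4 * CH * tau.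
have B0 : 0 <= B by rewrite /B; apply: addr_ge0; rewrite !mulr_ge0// ltW.
have E k' m' i' j' : in_grid k' m' -> i' != j' ->
    `|diag k' m' i' j'| <= (d%:R - 2) / d%:R * sup S + K.
  by rewrite -(subrK 1 k') => km' ij'; exact: diagonal_recursion.
(* in dimension one there are no diagonals, and the factor 1 - 2/d is negative *)
have [d2|d2] := leqP 2 d; last first.
  have ii (x y : 'I_d) : x = y by apply/val_inj; move: (ltn_ord x) (ltn_ord y) => /=; lia.
  apply: ge_sup; first exact: supS.1.
  by move=> _ [k' [m' [i' [j' [_ ->]]]]]; rewrite (ii i' j') /diag subrr normr0.
have SB : sup S <= (d%:R - 2) / d%:R * sup S + K.
  apply: ge_sup; first exact: supS.1.
  move=> _ [k' [m' [i' [j' [km' ->]]]]].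
  have [->|] := eqVneq i' j'; last exact: E.
  rewrite /diag subrr normr0 addr_ge0//.
    apply: mulr_ge0; last by exact: le_trans (HD k m i j km).
    by rewrite divr_ge0// ?subr_ge0 ?(ler_nat _ 2)// ltW.
  by rewrite /K addr_ge0// ?divr_ge0// !mulr_ge0// ltW.
have {}SB : sup S * (2 / d%:R) <= K.
  have : sup S * (2 / d%:R) = sup S - (d%:R - 2) / d%:R * sup S.
    by field; rewrite gt_eqF.
  by move=> ->; lra.
move: SB; rewrite -ler_pdivlMr ?divr_gt0// => /le_trans; apply.
by rewrite le_eqVlt; apply/orP; left; apply/eqP; rewrite /K /B; field; rewrite gt_eqF.
Qed.

Lemma neighbour_bound k m o o' : in_grid k m ->
  `|v k (m + dir o) - v k (m + dir o')| <= 6 * h * C + 2 * d%:R * CH * tau.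
Proof.
move=> km.
have H b j : `|v k (m + dir (b, j)) - v k (m + unit_step j)| <= 2 * h * C.
  case: b; rewrite ?dir_true ?dir_false; first by rewrite distrC; exact: vDx.
  by rewrite subrr normr0 !mulr_ge0// ltW.
case: o o' => [b i] [b' j].
have := H b i; have := H b' j; have := diagonal_bound i j km.
by rewrite !ler_norml => /andP[? ?] /andP[? ?] /andP[? ?]; apply/andP; split; lra.
Qed.

Lemma space_time_bound k m o : in_grid k m ->
  `|v (k + 1) m - v k (m + dir o)| <= 6 * h * C + 2 * d%:R * CH * tau + 2 * CH * tau.
Proof.
move=> km.
have := time_step_bound km.
have : `|neighbour_mean (v k) m - v k (m + dir o)| <= 6 * h * C + 2 * d%:R * CH * tau.
  by apply: neighbour_mean_close => // o'; exact: neighbour_bound.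
by rewrite !ler_norml => /andP[? ?] /andP[? ?]; apply/andP; split; lra.
Qed.

End Bounds.

(** * Extension of grid functions to space-time *)

Section Fill.
Context {R : realType} {d : nat}.
Hypothesis d_gt0 : (0 < d)%N.
Implicit Types (m n : 'rV[int]_d) (k : int) (v : int -> 'rV[int]_d -> R).

(** Filling the holes of the dual grid with the value at one fixed neighbour removes
    the parity constraint, so that the one-step estimates become a Lipschitz estimate
    on the whole index lattice. *)
Definition fill v k m : R :=
  if in_dual_grid k m then v k m else v k (m + unit_step (Ordinal d_gt0)).

Lemma fill_dual v k m : in_dual_grid k m -> fill v k m = v k m.
Proof. by rewrite /fill => ->. Qed.

Lemma lattice_lipschitz (S : zmodType) (f : S -> R) s (B : R) :
  (forall y, `|f (y + s) - f y| <= B) ->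
  forall (i : int) y, `|f (y + s *~ i) - f y| <= B * `|i%:~R|.
Proof.
move=> H.
have Hn i y : `|f (y + s *+ i) - f y| <= B * i%:R.
  elim: i y => [|i IH] y; first by rewrite addr0 subrr normr0 mulr0.
  rewrite mulrS addrA -(subrKA (f (y + s))) (le_trans (ler_normD _ _))//.
  by rewrite -natr1 mulrDr mulr1 lerD.
case=> i y; first by rewrite -pmulrn normr_nat.
rewrite NegzE mulrNz -pmulrn mulrNz normrN -pmulrn normr_nat distrC.
by have := Hn i.+1 (y - s *+ i.+1); rewrite subrK.
Qed.

Variables (v : int -> 'rV[int]_d -> R) (B : R).
Hypothesis B_space : forall k m o o', in_grid k m ->
  `|v k (m + dir o) - v k (m + dir o')| <= B.
Hypothesis B_time : forall k m o, in_grid k m -> `|v (k + 1) m - v k (m + dir o)| <= B.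

Let jd := Ordinal d_gt0.

Lemma fill_step k m j : `|fill v k (m + unit_step j) - fill v k m| <= B.
Proof.
rewrite /fill !stepE dualN; case: (boolP (in_grid k m)) => /= km.
  by have := B_space (false, j) (false, jd) km; rewrite !dir_false.
have gk : in_grid k (m + unit_step j) by rewrite stepE dualN.
by have := B_space (false, jd) (true, j) gk; rewrite dir_false dir_true addrK.
Qed.

Lemma fill_next k m : `|fill v (k + 1) m - fill v k m| <= B.
Proof.
rewrite /fill !stepE dualN; case: (boolP (in_grid k m)) => /= km.
  by have := B_time (false, jd) km; rewrite dir_false.
have gk : in_grid k (m + unit_step jd) by rewrite stepE dualN.
by have := B_time (true, jd) gk; rewrite dir_true addrK.
Qed.

Lemma fill_lipschitz k k' m m' : `|fill v k m - fill v k' m'|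
  <= B * (`|(k - k')%:~R| + \sum_j `|(m 0 j - m' 0 j)%:~R|).
Proof.
have T : `|fill v k m - fill v k' m| <= B * `|(k - k')%:~R|.
  have := @lattice_lipschitz int (fill v ^~ m) 1 B (fun y => fill_next y m) (k - k') k'.
  by rewrite intz subrKC.
have X s : `|fill v k' (m' + \sum_(j <- s) unit_step j *~ (m 0 j - m' 0 j)) - fill v k' m'|
    <= B * \sum_(j <- s) `|(m 0 j - m' 0 j)%:~R|.
  elim: s => [|j s IH]; first by rewrite !big_nil addr0 subrr normr0 mulr0.
  rewrite !big_cons [unit_step j *~ _ + _]addrC addrA.
  set y := m' + _ in IH *.
  rewrite -(subrKA (fill v k' y)) (le_trans (ler_normD _ _))// mulrDr lerD//.
  exact: (@lattice_lipschitz _ (fill v k') (unit_step j) B (fun y => fill_step k' y j)).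
have := X (index_enum _).
have -> : m' + \sum_j unit_step j *~ (m 0 j - m' 0 j) = m.
  apply/rowP => i; rewrite !mxE summxE (bigD1 i)//= big1 => [|j /negbTE ji];
    rewrite -scaler_int !mxE intz eqxx.
    by rewrite eqxx /= mulr1 addr0 subrKC.
  by rewrite eq_sym ji mulr0.
move=> {}X; rewrite -(subrKA (fill v k' m)) (le_trans (ler_normD _ _))// mulrDr.
exact: lerD.
Qed.

Lemma fill_period_x k m j i :
  (forall k m, in_dual_grid k m -> v k (m + unit_step j *+ (2 * i)) = v k m) ->
  fill v k (m + unit_step j *+ (2 * i)) = fill v k m.
Proof.
move=> H; rewrite /fill in_dual_grid_period_x; case: ifPn => km; first exact: H.
by rewrite addrAC H// stepE; move: km; rewrite dualN negbK.
Qed.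

Lemma fill_period_t k m i :
  (forall k m, in_dual_grid k m -> v (k + (2 * i)%N%:Z) m = v k m) ->
  fill v (k + (2 * i)%N%:Z) m = fill v k m.
Proof.
move=> H; rewrite /fill in_dual_grid_period_t; case: ifPn => km; first exact: H.
by rewrite H// stepE; move: km; rewrite dualN negbK.
Qed.

End Fill.

Section Extension.
Context {R : realType} {d : nat}.
Hypothesis d_gt0 : (0 < d)%N.
Variable delta : mesh.
Let h := hstep R delta.
Let tau := tstep R delta.
Let h0 : 0 < h := hstep_gt0 delta.
Let tau0 : 0 < tau := tstep_gt0 delta.
Implicit Types (v : int -> 'rV[int]_d -> R) (z : 'rV[R]_d * R).

Definition extend v z : R :=
  fill d_gt0 v (Num.floor (z.2 / tau)) (\row_j Num.floor (z.1 0 j / h)).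

Lemma extend_grid v k m : in_dual_grid k m ->
  extend v (xpt R delta m, tpt R delta k) = v k m.
Proof.
move=> km; rewrite /extend -(fill_dual d_gt0 v km); congr fill.
  by rewrite /= /tpt -/tau mulrAC divff ?gt_eqF// mul1r intrKfloor.
apply/rowP => j; rewrite !mxE -/h mulrAC divff ?gt_eqF// mul1r.
by rewrite intrKfloor.
Qed.

Lemma extend_bound v (M : R) : (forall k m, in_dual_grid k m -> `|v k m| <= M) ->
  forall z, `|extend v z| <= M.
Proof.
move=> H z; rewrite /extend /fill; case: ifPn => km; first exact: H.
by apply: H; rewrite stepE; move: km; rewrite dualN negbK.
Qed.

Lemma extend_period_x v j z :
  (forall k m, in_dual_grid k m -> v k (m + unit_step j *+ (2 * meshN delta)) = v k m) ->
  extend v (z.1 + basis_vec j, z.2) = extend v z.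
Proof.
move=> H; rewrite /extend /= -[RHS](fill_period_x d_gt0 _ _ H); congr fill.
apply/rowP => i; rewrite !mxE mulmxnE !mxE mulrDl.
have -> : (((0 : 'I_1) == 0) && (i == j))%:R / h = ((2 * meshN delta)%:Z *+ (i == j))%:~R :> R.
  by rewrite eqxx /=; case: eqP => _; rewrite ?mul0r// mul1r /h /hstep invrK pmulrn.
rewrite floorDrz ?intr_int// intrKfloor eqxx /=; congr (_ + _).
by case: (i == j); [rewrite !mulr1n natz|rewrite mulr0n mul0rn].
Qed.

Lemma extend_period_t v z :
  (forall k m, in_dual_grid k m -> v (k + (2 * meshK delta)%N%:Z) m = v k m) ->
  extend v (z.1, z.2 + 1) = extend v z.
Proof.
move=> H; rewrite /extend /= -[RHS](fill_period_t d_gt0 _ _ H); congr fill.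
have -> : (z.2 + 1) / tau = z.2 / tau + (2 * meshK delta)%:Z%:~R.
  by rewrite mulrDl mul1r /tau /tstep invrK pmulrn.
by rewrite floorDrz ?intr_int// intrKfloor.
Qed.

Lemma floor_dist (a b : R) : `|(Num.floor a - Num.floor b)%:~R| <= `|a - b| + 1.
Proof.
have := floor_le_tmp a; have := floorD1_gt a; rewrite intrD => H1 H2.
have := floor_le_tmp b; have := floorD1_gt b; rewrite intrD => H3 H4.
rewrite intrB ler_norml; have := ler_norm (a - b).
have := ler_norm (- (a - b)); rewrite normrN => *; apply/andP; split; lra.
Qed.

(** The extension is piecewise constant, which costs an additive error of the size of
    one grid step. *)
Lemma extend_lipschitz v (B Bh Bt : R) : B <= Bh * h -> B <= Bt * tau ->
  (forall k m o o', in_grid k m -> `|v k (m + dir o) - v k (m + dir o')| <= B) ->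
  (forall k m o, in_grid k m -> `|v (k + 1) m - v k (m + dir o)| <= B) ->
  forall z z', `|extend v z - extend v z'| <= (Bt + d%:R * Bh) * `|z - z'| + (1 + d%:R) * B.
Proof.
move=> BBh BBt Hs Ht z z'.
have B0 : 0 <= B.
  have := Hs 0 0 (false, Ordinal d_gt0) (false, Ordinal d_gt0).
  by rewrite subrr normr0 in_grid0; apply.
apply: (le_trans (fill_lipschitz d_gt0 Hs Ht _ _ _ _)).
have zx j : `|z.1 0 j - z'.1 0 j| <= `|z - z'|.
  rewrite prod_normE /= le_max; apply/orP; left.
  by have := rv_coord_le (z.1 - z'.1) j; rewrite !mxE.
have zt : `|z.2 - z'.2| <= `|z - z'| by rewrite prod_normE /= le_max lexx orbT.
have -> : (Bt + d%:R * Bh) * `|z - z'| + (1 + d%:R) * B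
   = (Bt * `|z - z'| + B) + \sum_(j < d) (Bh * `|z - z'| + B).
  by rewrite sumr_const card_ord -mulr_natl; ring.
have scale (a s Q : R) : 0 < s -> 0 <= a -> B <= Q * s -> B * (a / s + 1) <= Q * a + B.
  move=> s0 a0 Bs; rewrite mulrDr mulr1 lerD2r mulrCA mulrC ler_wpM2r//.
  by rewrite ler_pdivrMr.
rewrite mulrDr lerD//.
  apply: le_trans (scale _ _ _ tau0 (normr_ge0 (z - z')) BBt).
  rewrite ler_wpM2l// (le_trans (floor_dist _ _))// lerD2r -mulrBl normrM.
  by rewrite normfV (gtr0_norm tau0) ler_wpM2r// invr_ge0 ltW.
rewrite mulr_sumr; apply: ler_sum => j _.
apply: le_trans (scale _ _ _ h0 (normr_ge0 (z - z')) BBh).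
rewrite ler_wpM2l// !mxE (le_trans (floor_dist _ _))// lerD2r -mulrBl normrM.
by rewrite normfV (gtr0_norm h0) ler_wpM2r// invr_ge0 ltW.
Qed.

End Extension.

(** * Periodic solutions of the discrete cell equation *)

Section Cell.
Context {R : realType} {d : nat}.
Hypothesis d_gt0 : (0 < d)%N.
Variable L : 'rV[R]_d -> R -> 'rV[R]_d -> R.
Hypothesis HL : lagrangian L.
Variables (P : set 'rV[R]_d) (r lambda1 : R) (delta : mesh).
Hypothesis standing : standing_assumption L P r lambda1 delta.
Variables (c : 'rV[R]_d) (a : R) (v : int -> 'rV[int]_d -> R).
Hypothesis Pc : P c.
Hypothesis v_sol : periodic_cell_solution (hamiltonian L) delta r c a v.
Implicit Types (m n : 'rV[int]_d) (k : int).

Let h := hstep R delta.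
Let tau := tstep R delta.
Let tau0 : 0 < tau := tstep_gt0 delta.
Let H := hamiltonian L.

Lemma cell_scheme k m : in_grid k m ->
  v (k + 1) m = neighbour_mean (v k) m
    + tau * (a - H (xpt R delta m) (tpt R delta k) (c + Dx delta (v k) m)).
Proof.
move=> km; rewrite -(cell_eq v_sol km) DtE -/tau addrK mulVKf ?gt_eqF//.
by rewrite subrKC.
Qed.

Lemma Dx_shift w w' (b : R) k m : in_grid k m ->
  (forall n, in_dual_grid k n -> w n = w' n + b) -> Dx delta w m = Dx delta w' m.
Proof.
move=> km E; apply/rowP => j; rewrite !mxE !E ?stepE//.
by congr (_ / _); ring.
Qed.

(** The two evolutions differ by a constant at each time, so they have the same
    slopes and the CFL bound carries over. *)
Lemma evol_cell (k : nat) m : in_dual_grid k%:Z m ->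
  evol H delta c (v 0) k m = v k m - tpt R delta k%:Z * a.
Proof.
elim: k m => [|k IH] m km; first by rewrite /tpt mulr0 mul0r subr0.
have {}km : in_grid k%:Z m by move: km; rewrite -addn1 PoszD stepE.
have IH' n : in_dual_grid k%:Z n -> evol H delta c (v 0) k n = v k n + - (tpt R delta k%:Z * a).
  exact: IH.
rewrite /= (Dx_shift km IH') -[in RHS]addn1 PoszD (cell_scheme km).
have -> : (2 * d%:R)^-1 * \sum_o evol H delta c (v 0) k (m + dir o)
        = neighbour_mean (v k) m - tpt R delta k%:Z * a.
  have d0' : 0 < d%:R :> R by rewrite ltr0n.
  under eq_bigr do rewrite IH ?stepE//.
  rewrite sumrB mulrBr; congr (_ - _).
  rewrite sumr_const card_prod card_bool card_ord -[X in _ * X]mulr_natl natrM.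
  by field; rewrite gt_eqF.
by rewrite /tpt intrD -/tau; ring.
Qed.

Lemma cell_periods k m i : in_dual_grid k m ->
  v (k + (2 * (meshK delta * i))%N%:Z) m = v k m.
Proof.
move=> km; elim: i => [|i IH]; first by rewrite !muln0 addr0.
rewrite mulnS mulnDr addnC PoszD addrA (cell_periodic_t v_sol)//.
by rewrite in_dual_grid_period_t.
Qed.

Lemma tpt_periods k i : tpt R delta (k + (2 * (meshK delta * i))%N%:Z) = tpt R delta k + i%:~R.
Proof.
rewrite /tpt intrD mulrDr; congr (_ + _).
rewrite /tstep mulnA -!pmulrn [X in _ * X]natrM mulKf//.
by rewrite gt_eqF// ltr0n muln_gt0 meshK_gt0.
Qed.

(** For negative times periodicity in time brings the point to a nonnegative time. *)
Lemma cell_velocity k m : in_grid k m ->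
  `|gradient (H (xpt R delta m) (tpt R delta k)) (c + Dx delta (v k) m)|
    <= (d%:R * lambda1)^-1.
Proof.
move=> km.
have nat_case (k' : nat) : in_grid k'%:Z m ->
    `|gradient (H (xpt R delta m) (tpt R delta k'%:Z)) (c + Dx delta (v k'%:Z) m)|
    <= (d%:R * lambda1)^-1.
  move=> km'.
  have [] := standing_cfl standing Pc (cell_init v_sol) km'.
  rewrite /velocity -/H (_ : Dx delta (evol _ _ _ _ _) m = Dx delta (v k'%:Z) m)//.
  exact: (Dx_shift km' (@evol_cell k')).
pose k2 := k + (2 * (meshK delta * `|k|))%N%:Z.
have k2E : k2 = `|k2|%N%:Z.
  rewrite /k2; have := meshK_gt0 delta.
  by case: (meshK delta) => // K _; nia.
have := nat_case `|k2|%N; rewrite -k2E /k2 in_grid_period_t => /(_ km).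
rewrite tpt_periods.
have -> : H (xpt R delta m) (tpt R delta k + `|k|%N%:~R) = H (xpt R delta m) (tpt R delta k).
  rewrite /H -[RHS](hamiltonian_shift HL 0 `|k|%N).
  by rewrite (_ : map_mx _ _ = 0) ?addr0//; apply/matrixP => i j; rewrite !mxE.
by rewrite (@Dx_shift _ (v k) 0 k)// => n kn; rewrite addr0 cell_periods.
Qed.

(** Outside the CFL box the weights may be negative; the inequality holds there too,
    because it expresses that H is a supremum over all velocities. *)
Lemma cell_control_le k m xi : in_grid k m ->
  v (k + 1) m <= \sum_o jump_prob delta xi o * v k (m + dir o)
    + tau * (tilt L c (xpt R delta m) (tpt R delta k) xi + a).
Proof.
move=> km; rewrite cell_scheme// jump_mean -/tau /tilt.
have := hamiltonian_ge HL (xpt R delta m) (tpt R delta k) (c + Dx delta (v k) m) xi.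
rewrite -/H dotDl; set X := H _ _ _ => HX.
rewrite -subr_ge0; apply: le_trans (mulr_ge0 (ltW tau0) (_ : 0 <= X - (dot c xi + dot (Dx delta (v k) m) xi - L (xpt R delta m) (tpt R delta k) xi))) _.
  by rewrite subr_ge0.
by rewrite le_eqVlt; apply/orP; left; apply/eqP; ring.
Qed.

Lemma cell_control_eq k m : in_grid k m -> exists2 xi, `|xi| <= (d%:R * lambda1)^-1 &
  v (k + 1) m = \sum_o jump_prob delta xi o * v k (m + dir o)
    + tau * (tilt L c (xpt R delta m) (tpt R delta k) xi + a).
Proof.
move=> km; have := cell_velocity km; set p := c + _ => Hp.
have [Hz _] := hamiltonian_gradient HL (xpt R delta m) (tpt R delta k) p.
eexists; first exact: Hp.
rewrite cell_scheme// jump_mean -/tau /tilt -/p /H [hamiltonian L _ _ p]Hz /p dotDl.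
by ring.
Qed.

Lemma cell_slope (C : R) k m j :
  (forall x t z p, `|z| <= (d%:R * lambda1)^-1 ->
    (forall u, 'D_u (L x t) z = dot p u) -> `|p| <= C) ->
  in_grid k m -> `|v k (m + unit_step j) - v k (m - unit_step j)| <= 2 * h * (C + `|c|).
Proof.
move=> HC km.
have [_ Hz] := hamiltonian_gradient HL (xpt R delta m) (tpt R delta k) (c + Dx delta (v k) m).
have pC := HC _ _ _ _ (cell_velocity km) Hz.
have : `|Dx delta (v k) m| <= C + `|c|.
  by rewrite -(addKr c (Dx _ _ _)) addrC (le_trans (ler_normB _ _))// lerD2r.
move=> /(le_trans (rv_coord_le _ j)); rewrite mxE dir_false dir_true -/h.
have h0 : 0 < 2 * h by rewrite mulr_gt0// hstep_gt0.
by rewrite normrM normfV [X in _ / X]gtr0_norm// ler_pdivrMr// mulrC.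
Qed.

End Cell.

(** * Extraction of a uniformly convergent subsequence *)

Section Compactness.
Context {R : realType}.

Lemma ultrafilter_limit (U : set_system nat) (u : nat -> R) (M : R) :
  UltraFilter U -> (forall n, `|u n| <= M) ->
  exists p, forall e, 0 < e -> U [set n | `|u n - p| <= e].
Proof.
move=> UU uM.
have cM : compact `[-M, M] by exact: segment_compact.
have [|p [_ clp]] := cM (u @ U) _.
  apply: (@filterE _ U) => n; rewrite /= in_itv /= -ler_norml; exact: uM.
exists p => e e0.
have [//|UC] := in_ultra_setVsetC [set n | `|u n - p| <= e] UU.
have nB := nbhs_norm_ball p e0.
have UC' : (u @ U) [set y | ~ (`|y - p| <= e)] by exact: UC.
by have [y [/= H1 /ltW]] := clp _ _ UC' nB.
Qed.

Lemma extract_subsequence (P : nat -> nat -> Prop) :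
  (forall i n0, exists2 n, (n0 <= n)%N & P i n) ->
  exists2 sigma : nat -> nat, {homo sigma : i j / (i < j)%N} & forall i, P i (sigma i).
Proof.
move=> H.
have /choice[f Hf] (q : nat * nat) : exists n, (q.2 <= n)%N /\ P q.1 n.
  by have [n] := H q.1 q.2; exists n.
pose sigma := fix sigma i := if i is i'.+1 then f (i, (sigma i').+1) else f (0%N, 0%N).
exists sigma; last by case=> [|i]; [exact: (Hf (0%N, 0%N)).2|exact: (Hf (i.+1, _)).2].
by apply: homo_ltn => [i j k|i]; [exact: ltn_trans|exact: (Hf (i.+1, (sigma i).+1)).1].
Qed.

Context {d : nat}.
Implicit Types z : 'rV[R]_d * R.

(** Along an ultrafilter finer than the filter of large indices every bounded sequence
    converges, so the pointwise limit exists at once without a diagonal argument.  The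
    asymptotic Lipschitz bound and the compactness of the period cell make the
    convergence along the ultrafilter uniform, and then every accuracy is reached for
    arbitrarily large indices. *)
Theorem periodic_extraction (f : nat -> 'rV[R]_d * R -> R) (a eps : nat -> R) (M Lambda : R) :
  (forall n z, `|f n z| <= M) -> (forall n, `|a n| <= M) ->
  0 <= Lambda -> eps @ \oo --> (0 : R) ->
  (forall n z z', `|f n z - f n z'| <= Lambda * `|z - z'| + eps n) ->
  (forall n j z, f n (z.1 + basis_vec j, z.2) = f n z) ->
  (forall n z, f n (z.1, z.2 + 1) = f n z) ->
  exists sigma g b, [/\ {homo sigma : i j / (i < j)%N},
    (forall z z', `|g z - g z'| <= Lambda * `|z - z'|),
    (forall j z, g (z.1 + basis_vec j, z.2) = g z),
    (forall z, g (z.1, z.2 + 1) = g z) &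
    forall e, 0 < e -> exists n0, forall n, (n0 <= n)%N ->
      (forall z, `|f (sigma n) z - g z| <= e) /\ `|a (sigma n) - b| <= e].
Proof.
move=> fM aM L0 eps0 fL fx ft.
have [U [UU sU]] := ultraFilterLemma (@eventually_filter).
have lim (u : nat -> R) : (forall n, `|u n| <= M) ->
    exists p : R, forall e, 0 < e -> U [set n | `|u n - p| <= e].
  exact: ultrafilter_limit.
have /choice[g Hg] z := lim (f ^~ z) (fun n => fM n z).
have [b Hb] := lim a aM.
have epsU e : 0 < e -> U [set n | eps n <= e].
  move=> e0; apply: sU; have /cvgrPdist_le/(_ _ e0) := eps0.
  by apply: filterS => n; rewrite sub0r normrN; apply: le_trans; rewrite ler_norm.
have exU A : U A -> exists n, A n by exact: filter_ex.
have gL z z' : `|g z - g z'| <= Lambda * `|z - z'|.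
  apply/ler_addgt0Pr => e e0; have e3 : 0 < e / 3 by rewrite divr_gt0.
  have [n [/= [H1 H2] H3]] := exU _ (filterI (filterI (Hg z _ e3) (Hg z' _ e3)) (epsU _ e3)).
  have := fL n z z'; move: H1 H2 H3; rewrite !ler_norml => /= /andP[? ?] /andP[? ?] ? /andP[? ?].
  by apply/andP; split; lra.
have eq_lim z z' : (forall n, f n z = f n z') -> g z = g z'.
  move=> E; apply/eqP; rewrite -subr_eq0 -normr_eq0 eq_le normr_ge0 andbT.
  apply/ler_addgt0Pr => e e0; have e2 : 0 < e / 2 by rewrite divr_gt0.
  have [n [/= H1 H2]] := exU _ (filterI (Hg z _ e2) (Hg z' _ e2)).
  move: H1 H2; rewrite E !ler_norml => /andP[? ?] /andP[? ?].
  by apply/andP; split; lra.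
have gx j z : g (z.1 + basis_vec j, z.2) = g z by apply: eq_lim => n; exact: fx.
have gt z : g (z.1, z.2 + 1) = g z by apply: eq_lim => n; exact: ft.
have unifU e : 0 < e -> U [set n | forall z, `|f n z - g z| <= e].
  move=> e0; have e4 : 0 < e / 4 by rewrite divr_gt0.
  pose K := [set x : 'rV[R]_d | `|x| <= 1] `*` [set t : R | `|t| <= 1].
  have cK : compact K.
    apply: compact_setX; first exact: closed_ball_rV_compact.
    have -> : [set t : R | `|t| <= 1] = `[-1, 1]%classic.
      by apply/seteqP; split => t /=; rewrite in_itv /= ler_norml.
    exact: segment_compact.
  have step z : K z -> \forall z' \near z & n \near U, `|f n z' - g z'| <= e.
    move=> _.
    have l4 : 0 < e / 4 / (Lambda + 1) by rewrite !divr_gt0// ltr_wpDl.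
    have nB : nbhs z [set z' | `|z' - z| < e / 4 / (Lambda + 1)].
      exact: nbhs_norm_ball.
    exists ([set z' | `|z' - z| < e / 4 / (Lambda + 1)],
            [set n | `|f n z - g z| <= e / 4] `&` [set n | eps n <= e / 4]).
      by split => //=; exact: (filterI (Hg z _ e4) (epsU _ e4)).
    move=> [z' n] /= [Hz [H1 H2]].
    have H3 := fL n z' z; have H4 := gL z' z.
    have H5 : Lambda * `|z' - z| <= e / 4.
      apply: (@le_trans _ _ ((Lambda + 1) * `|z' - z|)).
        by rewrite ler_wpM2r// lerDl.
      by rewrite mulrC -ler_pdivlMr ?ltW// ltr_wpDl.
    move: H1 H3 H4; rewrite !ler_norml => /andP[? ?] /andP[? ?] /andP[? ?].
    by apply/andP; split; lra.
  have FU : Filter U by exact: _.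
  have := (compact_near_coveringP _).1 cK _ U (fun n z => `|f n z - g z| <= e) FU step.
  apply: filterS => n H [x t].
  have [m [k [Hx Ht]]] := cell_reduction x t.
  rewrite -(periodic_shift (fx n) (ft n) m k) -(periodic_shift gx gt m k).
  exact: H.
pose P i n := (forall z, `|f n z - g z| <= i.+1%:R^-1) /\ `|a n - b| <= i.+1%:R^-1.
have [i n0|sigma s_incr Hs] := @extract_subsequence P.
  have e0 : 0 < i.+1%:R^-1 :> R by rewrite invr_gt0.
  have UN : U [set n | (n0 <= n)%N] by apply: sU; exact: nbhs_infty_ge.
  by have [n [/= N [H1 H2]]] := exU _ (filterI UN (filterI (unifU _ e0) (Hb _ e0))); exists n.
exists sigma, g, b; split => // e e0.
have [n0 Hn0] : exists n0 : nat, e^-1 <= n0%:R.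
  by exists (Num.truncn e^-1).+1; rewrite ltW// truncnS_gt.
exists n0 => n n0n.
have le_e : n.+1%:R^-1 <= e.
  rewrite -[leRHS]invrK lef_pV2 ?posrE ?invr_gt0//.
  by rewrite (le_trans Hn0)// ler_nat ltnW.
have [H1 H2] := Hs n; split => [z|]; last exact: le_trans H2 _.
exact: le_trans (H1 z) _.
Qed.

End Compactness.

(** * Comparison with a test function *)

Section Touching.
Context {R : realType} {d : nat}.
Hypothesis d_gt0 : (0 < d)%N.
Implicit Types (x : 'rV[R]_d) (t : R) (m : 'rV[int]_d) (k : int).

Definition penalty x0 t0 (z : 'rV[R]_d * R) : R :=
  \sum_j (z.1 0 j - x0 0 j) ^+ 2 + (z.2 - t0) ^+ 2.

Lemma penalty_ge x0 t0 z : `|z - (x0, t0)| ^+ 2 <= penalty x0 t0 z.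
Proof.
have S0 : 0 <= \sum_j (z.1 0 j - x0 0 j) ^+ 2 by apply: sumr_ge0 => j _; exact: sqr_ge0.
rewrite prod_normE /= maxEle; case: ifP => _.
  by rewrite real_normK ?num_real// lerDr.
rewrite -ler_sqrt; last by rewrite addr_ge0// sqr_ge0.
rewrite sqrtr_sqr normr_id; apply: rv_norm_le => [|j]; first exact: sqrtr_ge0.
rewrite -sqrtr_sqr ler_sqrt; last by rewrite addr_ge0// sqr_ge0.
rewrite /penalty (bigD1 j)//= !mxE -addrA lerDl addr_ge0 ?sqr_ge0//.
by apply: sumr_ge0 => i _; exact: sqr_ge0.
Qed.

Lemma penalty_le x0 t0 z (rho : R) : `|z - (x0, t0)| <= rho ->
  penalty x0 t0 z <= (d%:R + 1) * rho ^+ 2.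
Proof.
rewrite prod_normE /= ge_max => /andP[Hx Ht].
rewrite mulrDl mul1r /penalty lerD//.
  apply: (@le_trans _ _ (\sum_(j < d) rho ^+ 2)); last first.
    by rewrite sumr_const card_ord mulr_natl.
  apply: ler_sum => j _; rewrite -[leLHS]real_normK ?num_real//.
  rewrite lerXn2r ?nnegrE//; first exact: le_trans Hx.
  by apply: le_trans Hx; have := rv_coord_le (z.1 - x0) j; rewrite !mxE.
by rewrite -[leLHS]real_normK ?num_real// lerXn2r ?nnegrE// (le_trans _ Ht).
Qed.

Lemma penalty_step_x x0 t0 x t j (s : R) :
  penalty x0 t0 (x + s *: basis_vec j, t) - penalty x0 t0 (x, t)
    = s * (2 * (x 0 j - x0 0 j) + s).
Proof.
rewrite /penalty /= (bigD1 j)//= [in X in _ - X](bigD1 j)//= !mxE !eqxx /=.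
have -> : \sum_(i < d | i != j) ((x + s *: basis_vec j) 0 i - x0 0 i) ^+ 2
        = \sum_(i < d | i != j) (x 0 i - x0 0 i) ^+ 2.
  apply: eq_bigr => i /negbTE ij.
  by rewrite !mxE ij andbF mulr0 addr0.
by rewrite mulr1; ring.
Qed.

Lemma penalty_step_t x0 t0 x t (s : R) :
  penalty x0 t0 (x, t + s) - penalty x0 t0 (x, t) = s * (2 * (t - t0) + s).
Proof. by rewrite /penalty /=; ring. Qed.

(** The penalty has derivative zero at (x0, t0), so it does not change the increments
    to first order. *)
Lemma penalized_increment (phi : 'rV[R]_d * R -> R) x0 t0 (e : R) : C1 phi -> 0 < e ->
  exists2 rho, 0 < rho & forall x t s, `|x - x0| <= rho -> `|t - t0| <= rho -> `|s| <= rho ->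
    let psi z := phi z + penalty x0 t0 z in
    (forall j, `|psi (x + s *: basis_vec j, t) - psi (x, t)
       - s * 'D_(basis_vec j, 0) phi (x0, t0)| <= e * `|s|) /\
    `|psi (x, t + s) - psi (x, t) - s * 'D_(0, 1) phi (x0, t0)| <= e * `|s|.
Proof.
move=> Cphi e0; have e2 : 0 < e / 2 by rewrite divr_gt0.
have /choice[rho Hrho] (j : 'I_d) : exists rho, 0 < rho /\ forall z s,
    `|z - (x0, t0)| <= rho -> `|s| <= rho ->
    `|phi (z + s *: (basis_vec j, 0)) - phi z - s * 'D_(basis_vec j, 0) phi (x0, t0)|
      <= e / 2 * `|s|.
  by have [rho] := C1_strict (x0, t0) (basis_vec j, 0) Cphi e2; exists rho.
have [rt rt0 Hrt] := C1_strict (x0, t0) (0, 1) Cphi e2.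
pose rm := \big[Num.min/Num.min rt (e / 6)]_j rho j.
have e6 : 0 < e / 6 by rewrite divr_gt0.
have rm0 : 0 < rm.
  by apply/bigmin_gtP; split => [|j _]; [rewrite lt_min rt0|exact: (Hrho j).1].
have rmj j : rm <= rho j by exact: bigmin_le_cond.
have rmt : rm <= rt by apply: le_trans (bigmin_le_id _ _ _ _) _; rewrite ge_min lexx.
have rme : rm <= e / 6.
  by apply: le_trans (bigmin_le_id _ _ _ _) _; rewrite ge_min lexx orbT.
exists rm => // x t s Hx Ht Hs psi.
have zz : `|(x, t) - (x0, t0)| <= rm by rewrite prod_normE ge_max Hx.
have pen (y : R) : `|y| <= rm -> `|s * (2 * y + s)| <= e / 2 * `|s|.
  move=> Hy; rewrite normrM mulrC ler_wpM2r// (le_trans (ler_normD _ _))//.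
  by rewrite normrM ger0_norm//; lra.
split=> [j|].
  have E : (x + s *: basis_vec j, t) = (x, t) + s *: (basis_vec j, 0) :> 'rV[R]_d * R.
    by congr (_, _); rewrite /= scaler0 addr0.
  have H1 := (Hrho j).2 (x, t) s (le_trans zz (rmj j)) (le_trans Hs (rmj j)).
  have H2 := pen (x 0 j - x0 0 j).
  have := penalty_step_x x0 t0 x t j s; move: H1 H2; rewrite -E /psi => H1 H2 H3.
  have {}H2 : `|s * (2 * (x 0 j - x0 0 j) + s)| <= e / 2 * `|s|.
    by apply: H2; have := rv_coord_le (x - x0) j; rewrite !mxE => /le_trans; apply.
  move: H1 H2; rewrite -H3 !ler_norml => /andP[? ?] /andP[? ?].
  by apply/andP; split; lra.
have E : (x, t + s) = (x, t) + s *: (0, 1) :> 'rV[R]_d * R.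
  by congr (_, _); rewrite /= ?scaler0 ?addr0// [s *: 1]mulr1.
have H1 := Hrt (x, t) s (le_trans zz rmt) (le_trans Hs rmt).
have H2 := pen _ Ht.
have := penalty_step_t x0 t0 x t s; move: H1 H2; rewrite -E /psi => H1 H2 H3.
move: H1 H2; rewrite -H3 !ler_norml => /andP[? ?] /andP[? ?].
by apply/andP; split; lra.
Qed.

Lemma xpt_step delta m b j i : xpt R delta (m + dir (b, j) *+ i)
  = xpt R delta m + ((-1) ^+ b * i%:R * hstep R delta) *: basis_vec j.
Proof.
apply/rowP => a; rewrite !mxE mulmxnE !mxE intrD mulrDr; congr (_ + _).
case: b; rewrite ?expr1 ?expr0 /=; case: (a == j); rewrite ?mulr1 ?mulr0 ?mul0rn ?mulr0//.
  by rewrite mulNrn natz intrN -pmulrn; ring.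
by rewrite mul1r natz -pmulrn; ring.
Qed.

Lemma tpt_next delta k : tpt R delta (k + 1) = tpt R delta k + tstep R delta.
Proof. by rewrite /tpt intrD mulrDr mulr1. Qed.

Lemma floor_grid (s a : R) : 0 < s -> `|s * (Num.floor (a / s))%:~R - a| <= s.
Proof.
move=> s0; have E : a = s * (a / s) by rewrite mulrC divfK// gt_eqF.
rewrite {2}E -mulrBr normrM gtr0_norm// -[leRHS]mulr1 ler_wpM2l ?(ltW s0)//.
have := floor_le_tmp (a / s); have := floorD1_gt (a / s); rewrite intrD => H1 H2.
by rewrite ler_norml; apply/andP; split; lra.
Qed.

Lemma dual_point_near delta x t : exists k m, [/\ in_dual_grid k m,
  `|xpt R delta m - x| <= 2 * hstep R delta & `|tpt R delta k - t| <= tstep R delta].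
Proof.
have h0 := hstep_gt0 (R := R) delta; have tau0 := tstep_gt0 (R := R) delta.
pose k := Num.floor (t / tstep R delta).
pose m : 'rV[int]_d := \row_j Num.floor (x 0 j / hstep R delta).
have Hk : `|tpt R delta k - t| <= tstep R delta by exact: floor_grid.
have Hm : `|xpt R delta m - x| <= hstep R delta.
  by apply: rv_norm_le => [|j]; [exact: ltW|rewrite !mxE; exact: floor_grid].
have [km|km] := boolP (in_dual_grid k m).
  by exists k, m; split => //; rewrite (le_trans Hm)//; lra.
pose j := Ordinal d_gt0; exists k, (m + unit_step j); split => //.
  by rewrite stepE; move: km; rewrite dualN negbK.
have := xpt_step delta m false j 1; rewrite dir_false mulr1n expr0 !mul1r => ->.
rewrite addrAC (le_trans (ler_normD _ _))// [leRHS]mulr_natl mulr2n lerD//.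
by rewrite normrZ gtr0_norm// -[leRHS]mulr1 ler_wpM2l ?(ltW h0)// basis_vec_le1.
Qed.

End Touching.

Section HalfLimit.
Context {R : realType} {d : nat}.
Hypothesis d_gt0 : (0 < d)%N.
Variables (delta : nat -> mesh).
Hypothesis h_small : forall e : R, 0 < e -> \forall n \near \oo, hstep R (delta n) <= e.
Hypothesis tau_small : forall e : R, 0 < e -> \forall n \near \oo, tstep R (delta n) <= e.
Variables (w : nat -> int -> 'rV[int]_d -> R) (g : 'rV[R]_d * R -> R).
Hypothesis g_continuous : continuous g.
Hypothesis w_unif : forall e, 0 < e -> \forall n \near \oo, forall k m,
  in_dual_grid k m -> `|w n k m - g (xpt R (delta n) m, tpt R (delta n) k)| <= e.
Implicit Types (x : 'rV[R]_d) (t : R) (m : 'rV[int]_d) (k : int).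

Let pt n k m := (xpt R (delta n) m, tpt R (delta n) k).

(** The penalty makes the maximum of g - phi strict, so a point where w - psi comes
    within rho tau of its supremum over a small ball lies well inside that ball, and so
    do its neighbours.  A near-maximizer suffices: the error rho tau is negligible after
    division by tau. *)
Lemma touching_points (phi : 'rV[R]_d * R -> R) x0 t0 (i : nat) (rho : R) :
  {for (x0, t0), continuous phi} ->
  (\forall z \near (x0, t0), g z - phi z <= g (x0, t0) - phi (x0, t0)) ->
  0 < rho ->
  let psi z := phi z + penalty x0 t0 z in
  \forall n \near \oo, exists k m,
    [/\ in_grid k m, `|xpt R (delta n) m - x0| <= rho, `|tpt R (delta n) k - t0| <= rho &
    forall o, w n k (m + dir o *+ (2 * i + 1)) - psi (pt n k (m + dir o *+ (2 * i + 1)))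
      <= w n (k + 1) m - psi (pt n (k + 1) m) + rho * tstep R (delta n)].
Proof.
move=> phi_cont Hmax rho0 psi; move: Hmax => /nbhs_normP[rho' /= rho'0 Hmax].
pose r1 := Num.min rho (rho' / 2).
have r10 : 0 < r1 by rewrite lt_min rho0 divr_gt0.
have r1rho : r1 <= rho by rewrite ge_min lexx.
have {}Hmax z : `|z - (x0, t0)| <= r1 -> g z - phi z <= g (x0, t0) - phi (x0, t0).
  move=> Hz; apply: Hmax => /=; rewrite distrC; apply: (le_lt_trans Hz).
  by rewrite gt_min; apply/orP; right; lra.
pose e1 := (r1 / 2) ^+ 2 / 10.
have r120 : 0 < (r1 / 2) ^+ 2 by rewrite exprn_gt0// divr_gt0.
have e10 : 0 < e1 by rewrite divr_gt0.
have [r2 r20 Hr2] : exists2 r2, 0 < r2 & forall z, `|z - (x0, t0)| <= r2 ->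
    `|phi z - phi (x0, t0)| <= e1 /\ `|g z - g (x0, t0)| <= e1.
  have [ra ra0 Ha] := continuous_dist phi_cont e10.
  have [rb rb0 Hb] := continuous_dist (@g_continuous (x0, t0)) e10.
  exists (Num.min ra rb) => [|z]; first by rewrite lt_min ra0.
  by rewrite le_min => /andP[za zb]; split; [exact: Ha|exact: Hb].
pose r3 := Num.min (Num.min r1 r2) (Num.min 1 (e1 / (d%:R + 1))).
have d10 : 0 < d%:R + 1 :> R by rewrite ltr_wpDl.
have r30 : 0 < r3.
  by rewrite lt_min; apply/andP; split; rewrite lt_min; apply/andP; split => //; rewrite divr_gt0.
have r3a : r3 <= Num.min r1 r2 by rewrite ge_min lexx.
have r3b : r3 <= Num.min 1 (e1 / (d%:R + 1)) by rewrite ge_min lexx orbT.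
have r3r1 : r3 <= r1 by rewrite (le_trans r3a)// ge_min lexx.
have r3r2 : r3 <= r2 by rewrite (le_trans r3a)// ge_min lexx orbT.
have r3e : (d%:R + 1) * r3 ^+ 2 <= e1.
  rewrite -ler_pdivlMl// mulrC (@le_trans _ _ r3)//.
    rewrite expr2 ler_piMl ?(ltW r30)// (le_trans r3b)// ge_min lexx //.
  by rewrite (le_trans r3b)// ge_min lexx orbT.
have r32 : 0 < r3 / 2 by rewrite divr_gt0.
have J0 : 0 < 2 * i%:R + 1 :> R by rewrite ltr_wpDl// mulr_ge0.
have r1J : 0 < r1 / 2 / (2 * i%:R + 1) by rewrite !divr_gt0.
have r12 : 0 < r1 / 2 by rewrite divr_gt0.
have rt : 0 < (r1 / 2) ^+ 2 / 2 / rho by rewrite !divr_gt0.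
near=> n.
have Hw : forall k m, in_dual_grid k m -> `|w n k m - g (pt n k m)| <= e1.
  by near: n; exact: w_unif.
have h1 : hstep R (delta n) <= r3 / 2 by near: n; exact: h_small.
have h2 : hstep R (delta n) <= r1 / 2 / (2 * i%:R + 1) by near: n; exact: h_small.
have t1 : tstep R (delta n) <= r3 by near: n; exact: tau_small.
have t2 : tstep R (delta n) <= r1 / 2 by near: n; exact: tau_small.
have t3 : tstep R (delta n) <= (r1 / 2) ^+ 2 / 2 / rho by near: n; exact: tau_small.
have tau0 := tstep_gt0 (R := R) (delta n); have h0 := hstep_gt0 (R := R) (delta n).
have ngh k m x t : `|pt n k m - (x, t)| = Num.max `|xpt R (delta n) m - x| `|tpt R (delta n) k - t|.
  by rewrite prod_normE.
pose S := [set a | exists k m, [/\ in_dual_grid k m, `|pt n k m - (x0, t0)| <= r1 &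
  a = w n k m - psi (pt n k m)]].
have Sub k m : in_dual_grid k m -> `|pt n k m - (x0, t0)| <= r1 ->
    w n k m - psi (pt n k m) <= g (x0, t0) - phi (x0, t0) + e1 - penalty x0 t0 (pt n k m).
  move=> km kmr; have := Hw k m km; have := Hmax _ kmr.
  by rewrite /psi ler_norml => ? /andP[? ?]; lra.
have [k1 [m1 [km1 Hm1 Hk1]]] := dual_point_near d_gt0 (delta n) x0 t0.
have km1r3 : `|pt n k1 m1 - (x0, t0)| <= r3.
  by rewrite ngh ge_max; apply/andP; split; lra.
have S1 : S (w n k1 m1 - psi (pt n k1 m1)).
  by exists k1, m1; split => //; exact: le_trans km1r3 r3r1.
have supS : has_sup S.
  split; first by exists (w n k1 m1 - psi (pt n k1 m1)).
  exists (g (x0, t0) - phi (x0, t0) + e1) => _ [k [m [km kmr ->]]].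
  apply: (le_trans (Sub _ _ km kmr)).
  by rewrite gerBl (le_trans _ (penalty_ge _ _ _))// sqr_ge0.
have rt0 : 0 < rho * tstep R (delta n) by rewrite mulr_gt0.
have [_ [k [m [km kmr ->]]] Hkm] := sup_adherent rt0 supS.
have lo : g (x0, t0) - phi (x0, t0) - 4 * e1 <= sup S.
  apply: (le_trans _ (ub_le_sup supS.2 S1)).
  have [H1 H2] := Hr2 _ (le_trans km1r3 r3r2).
  have H3 := le_trans (penalty_le km1r3) r3e.
  have H4 := Hw _ _ km1.
  by move: H1 H2 H4; rewrite /psi !ler_norml => /andP[? ?] /andP[? ?] /andP[? ?]; lra.
have close : `|pt n k m - (x0, t0)| <= r1 / 2.
  rewrite -(@ler_pXn2r _ 2) ?nnegrE//; last exact: ltW.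
  apply: (le_trans (penalty_ge _ _ _)).
  have := Sub _ _ km kmr; have : rho * tstep R (delta n) <= (r1 / 2) ^+ 2 / 2.
    by rewrite mulrC -ler_pdivlMr.
  rewrite /e1 in lo *; lra.
move: close; rewrite ngh ge_max => /andP[cx ct].
have tk : tpt R (delta n) (k - 1) = tpt R (delta n) k - tstep R (delta n).
  by rewrite -[in RHS](subrK 1 k) tpt_next addrK.
have Hk' : `|tpt R (delta n) (k - 1) - t0| <= r1.
  rewrite tk addrAC (le_trans (ler_normB _ _))// (splitr r1) lerD//.
  by rewrite gtr0_norm.
exists (k - 1), m; split.
- by rewrite stepE.
- by rewrite (le_trans cx)//; lra.
- exact: le_trans r1rho.
- move=> o; rewrite subrK; set m' := m + _.
  suff : w n (k - 1) m' - psi (pt n (k - 1) m') <= sup S by lra.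
  apply: ub_le_sup; first exact: supS.2.
  exists (k - 1), m'; split => //; first by rewrite in_dual_grid_wide stepE.
  rewrite ngh ge_max Hk' andbT /m'; case: o {m'} => b j.
  rewrite xpt_step addrAC (le_trans (ler_normD _ _))// (splitr r1) lerD//.
  rewrite normrZ !normrM normr_sign mul1r normr_nat (gtr0_norm h0).
  rewrite -[leRHS]mulr1 ler_pM ?basis_vec_le1 ?mulr_ge0 ?(ltW h0)//.
  rewrite mulrC -ler_pdivlMr; first by rewrite natrD natrM.
  by rewrite natrD natrM.
Unshelve. all: by end_near.
Qed.

Variable lambda0 : R.
Hypothesis lambda0_gt0 : 0 < lambda0.
Hypothesis lambda_ge : forall n, lambda0 <= mesh_ratio R (delta n).

(** With nonnegative weights the scheme inequality for w passes to psi at a touching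
    point; expanding psi to first order gives the inequality for its derivatives, where
    the wide stencil of width J = 2 i + 1 has the right mean displacement because the
    velocity in the weights is divided by J.  The assumption lambda0 <= tau / h turns
    errors of order h into errors of order tau. *)
Lemma half_limit (phi : 'rV[R]_d * R -> R) x0 t0 (i : nat)
    (xi : nat -> int -> 'rV[int]_d -> 'rV[R]_d) (ell : nat -> int -> 'rV[int]_d -> R) (e : R) :
  C1 phi ->
  (\forall z \near (x0, t0), g z - phi z <= g (x0, t0) - phi (x0, t0)) ->
  (\forall n \near \oo, forall k m o, in_grid k m ->
     0 <= jump_prob (delta n) ((2 * i + 1)%:R^-1 *: xi n k m) o) ->
  (\forall n \near \oo, forall k m, in_grid k m -> w n (k + 1) m <=
     \sum_o jump_prob (delta n) ((2 * i + 1)%:R^-1 *: xi n k m) o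
        * w n k (m + dir o *+ (2 * i + 1)) + tstep R (delta n) * ell n k m) ->
  0 < e ->
  \forall n \near \oo, exists k m,
    [/\ in_grid k m, `|xpt R (delta n) m - x0| <= e, `|tpt R (delta n) k - t0| <= e &
      'D_(0, 1) phi (x0, t0) + \sum_j xi n k m 0 j * 'D_(basis_vec j, 0) phi (x0, t0)
        <= ell n k m + e].
Proof.
move=> Cphi Hmax pos scheme e0.
pose J : R := (2 * i + 1)%:R.
have J0 : 0 < J by rewrite ltr0n addn1.
have q0 : 0 < 1 + J / lambda0 by rewrite addr_gt0// divr_gt0.
pose e1 := e / 2 / (1 + J / lambda0).
have e10 : 0 < e1 by rewrite !divr_gt0.
have [r1 r10 Hr1] := penalized_increment x0 t0 Cphi e10.
pose rho := Num.min (e / 4) r1.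
have rho0 : 0 < rho by rewrite lt_min r10 divr_gt0.
have rhoe : rho <= e / 4 by rewrite ge_min lexx.
have rhor1 : rho <= r1 by rewrite ge_min lexx orbT.
have phi_cont : {for (x0, t0), continuous phi}.
  exact: (differentiable_continuous (Cphi.1 (x0, t0))).
have rJ : 0 < r1 / J by rewrite divr_gt0.
near=> n.
have [k [m [km Hx Ht Hw]]] : exists k m,
    [/\ in_grid k m, `|xpt R (delta n) m - x0| <= rho, `|tpt R (delta n) k - t0| <= rho &
    forall o, w n k (m + dir o *+ (2 * i + 1))
        - (phi (pt n k (m + dir o *+ (2 * i + 1))) + penalty x0 t0 (pt n k (m + dir o *+ (2 * i + 1))))
      <= w n (k + 1) m - (phi (pt n (k + 1) m) + penalty x0 t0 (pt n (k + 1) m))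
         + rho * tstep R (delta n)].
  by near: n; exact: (touching_points i phi_cont Hmax rho0).
have pos' : forall k m o, in_grid k m ->
     0 <= jump_prob (delta n) ((2 * i + 1)%:R^-1 *: xi n k m) o by near: n.
have scheme' : forall k m, in_grid k m -> w n (k + 1) m <=
     \sum_o jump_prob (delta n) ((2 * i + 1)%:R^-1 *: xi n k m) o
        * w n k (m + dir o *+ (2 * i + 1)) + tstep R (delta n) * ell n k m by near: n.
have h1 : hstep R (delta n) <= r1 / J by near: n; exact: h_small.
have t1 : tstep R (delta n) <= r1 by near: n; exact: tau_small.
exists k, m; split => //; [lra|lra|].
move: {scheme' pos'}(scheme' _ _ km) (pos' _ _ ^~ km) => scheme' pos'.
have tau0 := tstep_gt0 (R := R) (delta n); have h0 := hstep_gt0 (R := R) (delta n).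
set tau := tstep _ _ in tau0 t1 scheme' Hw *; set h := hstep _ _ in h0 h1.
have hJ : `|h * J| <= r1 by rewrite gtr0_norm ?mulr_gt0// -ler_pdivlMr.
have htau : h <= tau / lambda0.
  rewrite ler_pdivlMr// /tau -(mesh_ratioE (R := R) (delta n)) mulrC ler_wpM2r//.
  exact: ltW.
pose psi z := phi z + penalty x0 t0 z.
pose W := w n (k + 1) m - psi (pt n (k + 1) m) + rho * tau.
pose psi0 := psi (pt n k m).
set Dt := 'D_(0, 1) phi (x0, t0); pose D j := 'D_(basis_vec j, 0) phi (x0, t0).
rewrite -[\sum_j _]/(\sum_j xi n k m 0 j * D j).
have Hpt : psi0 + tau * Dt - e1 * tau <= psi (pt n (k + 1) m).
  have t1' : `|tau| <= r1 by rewrite gtr0_norm.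
  have [_] := Hr1 _ _ tau (le_trans Hx rhor1) (le_trans Ht rhor1) t1'.
  rewrite (gtr0_norm tau0) ler_norml => /andP[+ _].
  by rewrite -tpt_next -/(pt n k m) -/(pt n (k + 1) m) -/(psi _) -/(psi _) -/psi0 -/Dt; lra.
have Hpx o : w n k (m + dir o *+ (2 * i + 1))
    <= (W + psi0 + e1 * (J * h)) + (-1) ^+ o.1 * (J * h * D o.2).
  have := Hw o; rewrite -/(psi _) -/(psi _) -/W.
  case: o => b j /=.
  have sr : `|(-1) ^+ b * J * h| <= r1.
    by rewrite -mulrA normrM normr_sign mul1r mulrC.
  have [/(_ j) + _] := Hr1 _ _ _ (le_trans Hx rhor1) (le_trans Ht rhor1) sr.
  rewrite -xpt_step -/(pt n k _) -/(pt n k m) -/(psi _) -/(psi _) -/psi0 -/(D j).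
  rewrite -[X in e1 * `|X|]mulrA normrM normr_sign mul1r (gtr0_norm (mulr_gt0 J0 h0)).
  by rewrite ler_norml => /andP[_ +]; lra.
have Hsum : \sum_o jump_prob (delta n) ((2 * i + 1)%:R^-1 *: xi n k m) o
        * w n k (m + dir o *+ (2 * i + 1))
    <= (W + psi0 + e1 * (J * h)) - tau * \sum_j xi n k m 0 j * D j.
  apply: (le_trans (ler_sum _ (fun o _ => ler_wpM2l (pos' o) (Hpx o)))).
  rewrite (jump_prob_affine _ _ _ (fun j => J * h * D j))// lerD2l lerN2.
  rewrite le_eqVlt; apply/orP; left; apply/eqP; rewrite !mulr_sumr; apply: eq_bigr => j _.
  rewrite mxE -/J /tau -(mesh_ratioE (R := R) (delta n)) -/h; field.
  by rewrite gt_eqF.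
have key : tau * (Dt + \sum_j xi n k m 0 j * D j) <= tau * (ell n k m + e).
  have H1 := le_trans scheme' (lerD Hsum (lexx _)).
  have H2 : e1 * (J * h) <= e1 * (J / lambda0) * tau.
    rewrite -[leRHS]mulrA; apply: ler_wpM2l; first exact: ltW.
    by rewrite -mulrA; apply: ler_wpM2l; [exact: ltW|rewrite mulrC].
  have H3 : e1 * tau + e1 * (J / lambda0) * tau = e / 2 * tau.
    by rewrite -mulrDl -[X in X + _]mulr1 -mulrDr /e1 divfK// gt_eqF.
  have H4 : rho * tau <= e / 4 * tau by rewrite ler_wpM2r// ltW.
  have H5 : 0 < e * tau by rewrite mulr_gt0.
  by move: H1 Hpt; rewrite /W => H1 Hpt; lra.
by rewrite ler_pM2l in key.
Unshelve. all: by end_near.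
Qed.

End HalfLimit.

(** * Averaging over translates and wide stencils *)

Section SecondDifference.
Context {R : realType}.

Lemma second_difference (f : int -> R) (b : R) :
  (forall i, `|f (i + 1) - 2 * f i + f (i - 1)| <= b) ->
  forall s : nat, `|f s%:Z - f 0 - s%:R * (f 0 - f (- 1))| <= b * s%:R ^+ 2.
Proof.
move=> H; have b0 : 0 <= b by exact: le_trans (H 0).
have first (s : nat) : `|f (s%:Z + 1) - f s%:Z - (f 0 - f (- 1))| <= b * s.+1%:R.
  elim: s => [|s IH].
    by have := H 0; rewrite !add0r mulr1 !ler_norml => /andP[? ?]; apply/andP; split; lra.
  have := H (s%:Z + 1); rewrite addrK.
  have -> : s.+1%:Z = s%:Z + 1 by rewrite -addn1 PoszD.
  rewrite -[s.+2]addn1 [in X in _ -> X]natrD mulrDr mulr1.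
  move: IH; rewrite !ler_norml => /andP[? ?] /andP[? ?].
  by apply/andP; split; lra.
elim=> [|s IH]; first by rewrite subrr mul0r subr0 normr0 expr0n mulr0.
have := first s; move: IH; rewrite -[s.+1]addn1 PoszD !natrD !ler_norml.
have s0 : 0 <= b * s%:R by rewrite mulr_ge0.
by move=> /andP[? ?] /andP[? ?]; apply/andP; split; lra.
Qed.

End SecondDifference.

Section Averaging.
Context {R : realType} {d : nat}.
Variable q : nat.
Hypothesis q_gt0 : (0 < q)%N.
Implicit Types (u F : int -> 'rV[int]_d -> R) (m : 'rV[int]_d) (k : int) (i j : 'I_d).

Let q0 : 0 < q%:R :> R. Proof. by rewrite ltr0n. Qed.

(** Only even multiples of the unit step: they preserve parity. *)
Definition slide j u : int -> 'rV[int]_d -> R :=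
  fun k m => q%:R^-1 * \sum_(a < q) u k (m + unit_step j *+ (2 * a)).

Definition mollify u := foldr slide u (enum 'I_d).

Lemma mean_le (x : 'I_q -> R) (b : R) : (forall a, `|x a| <= b) ->
  `|q%:R^-1 * \sum_a x a| <= b.
Proof.
move=> H; rewrite normrM gtr0_norm ?invr_gt0// ler_pdivrMl//.
apply: (le_trans (ler_norm_sum _ _ _)).
apply: (le_trans (ler_sum _ (fun a _ => H a))).
by rewrite sumr_const card_ord mulr_natl.
Qed.

Definition first_difference_bound u (b : R) :=
  forall k m i, in_dual_grid k m -> `|u k (m + unit_step i *+ 2) - u k m| <= b.

Definition second_difference_bound u i (b : R) := forall k m, in_dual_grid k m ->
  `|u k (m + unit_step i *+ 2) - 2 * u k m + u k (m - unit_step i *+ 2)| <= b.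

Lemma slide_first_difference j u b :
  first_difference_bound u b -> first_difference_bound (slide j u) b.
Proof.
move=> H k m i km; rewrite /slide -mulrBr -sumrB; apply: mean_le => a.
by rewrite addrAC; apply: H; rewrite in_dual_grid_period_x.
Qed.

Lemma slide_second_difference j u i b :
  second_difference_bound u i b -> second_difference_bound (slide j u) i b.
Proof.
move=> H k m km; rewrite /slide.
have -> : forall x y z : 'I_q -> R, q%:R^-1 * (\sum_a x a) - 2 * (q%:R^-1 * (\sum_a y a))
    + q%:R^-1 * (\sum_a z a) = q%:R^-1 * \sum_a (x a - 2 * y a + z a).
  by move=> x y z; rewrite big_split sumrB -mulr_sumr /=; ring.
apply: mean_le => a; rewrite [m + _ *+ 2 + _]addrAC [m - _ + _]addrAC.
by apply: H; rewrite in_dual_grid_period_x.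
Qed.

Lemma slide_telescope j u k m : slide j u k (m + unit_step j *+ 2) - slide j u k m
  = q%:R^-1 * (u k (m + unit_step j *+ (2 * q)) - u k m).
Proof.
rewrite /slide -mulrBr -sumrB; congr (_ * _).
pose g (a : nat) := u k (m + unit_step j *+ (2 * a)).
have -> : u k m = g 0%N by rewrite /g muln0 addr0.
rewrite -[u k (m + _ *+ (2 * q))]/(g q) -(telescope_sumr g (leq0n q)) big_mkord.
apply: eq_bigr => a _; congr (_ - _); rewrite /g -addrA -mulrnDr; congr (u k (m + _ *+ _)); lia.
Qed.

(** The first difference of the mean telescopes to a difference over a distance of
    2 q steps divided by q; its own difference is bounded by first differences. *)
Lemma slide_gain j u b : first_difference_bound u b ->
  second_difference_bound (slide j u) j (2 * b / q%:R).
Proof.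
move=> H k m km.
have E1 := slide_telescope j u k m.
have E2 := slide_telescope j u k (m - unit_step j *+ 2); rewrite subrK in E2.
have -> : slide j u k (m + unit_step j *+ 2) - 2 * slide j u k m + slide j u k (m - unit_step j *+ 2)
  = q%:R^-1 * ((u k (m + unit_step j *+ (2 * q)) - u k (m - unit_step j *+ 2 + unit_step j *+ (2 * q)))
     - (u k m - u k (m - unit_step j *+ 2))).
  transitivity ((slide j u k (m + unit_step j *+ 2) - slide j u k m)
     - (slide j u k m - slide j u k (m - unit_step j *+ 2))); first by ring.
  by rewrite E1 E2; ring.
rewrite normrM gtr0_norm ?invr_gt0// mulrC ler_wpM2r ?invr_ge0 ?(ltW q0)//.
apply: (le_trans (ler_normB _ _)); rewrite mulr_natl mulr2n lerD//.
  set m' := m - _ + _; have -> : m + unit_step j *+ (2 * q) = m' + unit_step j *+ 2.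
    by rewrite /m' addrAC subrK.
  apply: H; rewrite /m' in_dual_grid_period_x.
  by rewrite -(in_dual_grid_period_x _ _ j 1) muln1 subrK.
have := H k (m - unit_step j *+ 2) j; rewrite subrK; apply.
by rewrite -(in_dual_grid_period_x _ _ j 1) muln1 subrK.
Qed.

Lemma mollify_second_difference u b j : first_difference_bound u b ->
  second_difference_bound (mollify u) j (2 * b / q%:R).
Proof.
move=> H; rewrite /mollify; have : j \in enum 'I_d by rewrite mem_enum.
have Hs s : first_difference_bound (foldr slide u s) b.
  by elim: s => [//|i s IH]; exact: slide_first_difference.
elim: (enum _) => [//|i s IH]; rewrite inE => /orP[/eqP ->|js] /=.
  exact: slide_gain.
exact: slide_second_difference (IH js).
Qed.

End Averaging.

Section AveragedScheme.
Context {R : realType} {d : nat}.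
Variables (delta : mesh) (q : nat).
Hypothesis q_gt0 : (0 < q)%N.
Implicit Types (u F : int -> 'rV[int]_d -> R) (m : 'rV[int]_d) (k : int) (i j : 'I_d).

Let h := hstep R delta.
Let tau := tstep R delta.
Let h0 : 0 < h := hstep_gt0 delta.
Let q0 : 0 < q%:R :> R. Proof. by rewrite ltr0n. Qed.

Lemma slide_scheme j u F xi :
  (forall k m, in_grid k m -> u (k + 1) m
     <= \sum_o jump_prob delta xi o * u k (m + dir o) + tau * F k m) ->
  forall k m, in_grid k m -> slide q j u (k + 1) m
     <= \sum_o jump_prob delta xi o * slide q j u k (m + dir o) + tau * slide q j F k m.
Proof.
move=> H k m km; rewrite /slide.
have -> : \sum_o jump_prob delta xi o *
     (q%:R^-1 * \sum_(a < q) u k (m + dir o + unit_step j *+ (2 * a)))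
   + tau * (q%:R^-1 * \sum_(a < q) F k (m + unit_step j *+ (2 * a)))
   = q%:R^-1 * \sum_(a < q) (\sum_o jump_prob delta xi o
       * u k (m + unit_step j *+ (2 * a) + dir o) + tau * F k (m + unit_step j *+ (2 * a))).
  rewrite big_split /= mulrDr exchange_big /=; congr (_ + _).
    rewrite mulr_sumr; apply: eq_bigr => o _.
    by rewrite mulrCA mulr_sumr; congr (_ * _); apply: eq_bigr => a _; rewrite addrAC.
  by rewrite -mulr_sumr mulrCA.
rewrite ler_pM2l ?invr_gt0//; apply: ler_sum => a _; apply: H.
by rewrite in_grid_period_x.
Qed.

Lemma slides_scheme (s : seq 'I_d) u F xi :
  (forall k m, in_grid k m -> u (k + 1) m
     <= \sum_o jump_prob delta xi o * u k (m + dir o) + tau * F k m) ->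
  forall k m, in_grid k m -> foldr (slide q) u s (k + 1) m
     <= \sum_o jump_prob delta xi o * foldr (slide q) u s k (m + dir o) + tau * foldr (slide q) F s k m.
Proof. by move=> H; elim: s => [//|j s IH]; exact: slide_scheme. Qed.

(** The means stay close to the function because the translates stay within a distance
    proportional to q h. *)
Lemma slides_close (s : seq 'I_d) u k m (b e : R) :
  (forall m', in_grid k m' = in_grid k m ->
     `|xpt R delta m' - xpt R delta m| <= (size s)%:R * (2 * q%:R * h) -> `|u k m' - b| <= e) ->
  `|foldr (slide q) u s k m - b| <= e.
Proof.
elim: s m => [|j s IH] m H /=.
  by apply: H => //; rewrite subrr normr0 mul0r.
have -> : slide q j (foldr (slide q) u s) k m - b
   = q%:R^-1 * \sum_(a < q) (foldr (slide q) u s k (m + unit_step j *+ (2 * a)) - b).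
  rewrite sumrB mulrBr; congr (_ - _).
  by rewrite sumr_const card_ord -[b *+ q]mulr_natl mulKf// gt_eqF.
apply: (mean_le q_gt0) => a; apply: IH => m' gm' Hm'; apply: H.
  by rewrite gm' in_grid_period_x.
rewrite -(subrKA (xpt R delta (m + unit_step j *+ (2 * a)))) (le_trans (ler_normD _ _))//.
rewrite /= -(addn1 (size s)) natrD mulrDl mul1r lerD//.
have := xpt_step (R := R) delta m false j (2 * a); rewrite dir_false /= expr0 mul1r => ->.
rewrite addrAC subrr add0r normrZ normrM normr_nat (gtr0_norm h0).
rewrite -[leRHS]mulr1 ler_pM ?basis_vec_le1 ?mulr_ge0 ?(ltW h0)//.
by rewrite ler_wpM2r ?(ltW h0)// natrM ler_wpM2l// ler_nat ltnW.
Qed.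

End AveragedScheme.

Section WideStencil.
Context {R : realType} {d : nat}.
Hypothesis d_gt0 : (0 < d)%N.
Variable delta : mesh.
Implicit Types (u : int -> 'rV[int]_d -> R) (m : 'rV[int]_d) (k : int) (i j : 'I_d).

Let h := hstep R delta.
Let tau := tstep R delta.
Let h0 : 0 < h := hstep_gt0 delta.
Let tau0 : 0 < tau := tstep_gt0 delta.

(** When the second differences are small, u is almost affine along each line, and both
    sides average an affine function to the same value: dividing the velocity by the
    width of the stencil keeps the mean displacement. *)
Lemma wide_stencil u (b : R) (s : nat) xi k m :
  (forall j, second_difference_bound u j b) -> in_grid k m ->
  \sum_o jump_prob delta xi o * u k (m + dir o)
    <= \sum_o jump_prob delta ((2 * s + 1)%:R^-1 *: xi) o * u k (m + dir o *+ (2 * s + 1))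
       + d%:R * (b * s%:R ^+ 2 * (1 + mesh_ratio R delta * `|xi|)).
Proof.
move=> H km; rewrite !sum_dir.
have -> : d%:R * (b * s%:R ^+ 2 * (1 + mesh_ratio R delta * `|xi|))
   = \sum_(j < d) b * s%:R ^+ 2 * (1 + mesh_ratio R delta * `|xi|).
  by rewrite sumr_const card_ord mulr_natl.
rewrite -big_split; apply: ler_sum => j _ /=.
rewrite /jump_prob !dot_dir !expr0 !expr1 !mxE !dir_false !dir_true.
have b0 : 0 <= b.
  have := H j k (m + unit_step j); rewrite stepE => /(_ km); exact: le_trans.
(* the neighbours of m along the axis j are the values f 0 and f (-1) *)
pose f (i : int) := u k (m + unit_step j *~ (2 * i + 1)).
have Hf (i : int) : `|f (i + 1) - 2 * f i + f (i - 1)| <= b.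
  have -> : f (i + 1) = u k (m + unit_step j *~ (2 * i + 1) + unit_step j *+ 2).
    rewrite /f -[unit_step j *+ 2]/(unit_step j *~ 2) -addrA -mulrzDr; congr (u k (m + _ *~ _)); lia.
  have -> : f (i - 1) = u k (m + unit_step j *~ (2 * i + 1) - unit_step j *+ 2).
    rewrite /f -[unit_step j *+ 2]/(unit_step j *~ 2) -mulrNz -addrA -mulrzDr; congr (u k (m + _ *~ _)); lia.
  by apply: H; rewrite in_dual_grid_odd.
have Hf' (i : int) : `|f (-1 - (i + 1)) - 2 * f (-1 - i) + f (-1 - (i - 1))| <= b.
  have := Hf (-1 - i).
  have -> : -1 - i + 1 = -1 - (i - 1) by lia.
  have -> : -1 - i - 1 = -1 - (i + 1) by lia.
  by rewrite !ler_norml => /andP[? ?]; apply/andP; split; lra.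
have X := second_difference Hf s.
have Y := second_difference (f := fun i : int => f (-1 - i)) Hf' s.
have Es : f s%:Z = u k (m + unit_step j *+ (2 * s + 1)).
  by rewrite /f [_ *+ (2 * s + 1)]pmulrn; congr (u k (m + _ *~ _)); lia.
have Es' : f (-1 - s%:Z) = u k (m + - unit_step j *+ (2 * s + 1)).
  by rewrite /f mulNrn [_ *+ (2 * s + 1)]pmulrn -mulrNz; congr (u k (m + _ *~ _)); lia.
have E0 : f 0 = u k (m + unit_step j) by rewrite /f mulr0 add0r.
have E1 : f (-1) = u k (m - unit_step j) by rewrite /f.
move: X Y; rewrite /= subr0 opprK addNr Es Es' E0 E1.
set f0 := u k (m + unit_step j); set g0 := u k (m - unit_step j).
set fs := u k _; set gs := u k _ => X Y.
set p := mesh_ratio R delta.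
have p0 : 0 < p by rewrite /p /mesh_ratio divr_gt0.
have J1 : 1 <= (2 * s + 1)%:R :> R by rewrite ler1n addn1.
have J0 : 0 < (2 * s + 1)%:R :> R by rewrite (lt_le_trans _ J1).
have EJ : (2 * s + 1)%:R = 2 * s%:R + 1 :> R by rewrite natrD natrM.
set x := fs - f0 - s%:R * (f0 - g0) in X.
set y := gs - g0 - s%:R * (g0 - f0) in Y.
set J := (2 * s + 1)%:R in J0 J1 EJ *.
have d0' : 0 < d%:R :> R by rewrite ltr0n.
have d1 : (d%:R)^-1 <= 1 :> R by rewrite invf_le1// ler1n.
(* the wide average minus the narrow one, in terms of the deviations x and y from the
   affine extrapolation *)
have E : ((2 * d%:R)^-1 - p / 2 * (1 * (J^-1 * xi 0 j))) * fs
       + ((2 * d%:R)^-1 - p / 2 * (-1 * (J^-1 * xi 0 j))) * gs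
       - (((2 * d%:R)^-1 - p / 2 * (1 * xi 0 j)) * f0 + ((2 * d%:R)^-1 - p / 2 * (-1 * xi 0 j)) * g0)
   = d%:R^-1 * ((x + y) / 2) - J^-1 * (p * xi 0 j) * ((x - y) / 2).
  have -> : fs = x + f0 + s%:R * (f0 - g0) by rewrite /x; ring.
  have -> : gs = y + g0 + s%:R * (g0 - f0) by rewrite /y; ring.
  rewrite EJ in J0 *; field.
  by rewrite !gt_eqF.
set B := b * s%:R ^+ 2 in X Y *.
have B0 : 0 <= B by exact: le_trans X.
have hx : `|(x + y) / 2| <= B by move: X Y; rewrite !ler_norml => /andP[? ?] /andP[? ?]; apply/andP; split; lra.
have hy : `|(x - y) / 2| <= B by move: X Y; rewrite !ler_norml => /andP[? ?] /andP[? ?]; apply/andP; split; lra.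
have H1 : `|d%:R^-1 * ((x + y) / 2)| <= B.
  rewrite normrM gtr0_norm ?invr_gt0// -[leRHS]mul1r ler_pM// invr_ge0 ltW//.
have H2 : `|J^-1 * (p * xi 0 j) * ((x - y) / 2)| <= p * `|xi| * B.
  rewrite normrM ler_pM// -[leRHS]mul1r normrM ler_pM//.
    by rewrite gtr0_norm ?invr_gt0// invf_le1.
  by rewrite normrM (gtr0_norm p0) ler_wpM2l ?(ltW p0)// rv_coord_le.
have H3 := ler_norm (- (d%:R^-1 * ((x + y) / 2))).
have H4 := ler_norm (J^-1 * (p * xi 0 j) * ((x - y) / 2)).
rewrite normrN in H3.
have -> : B * (1 + p * `|xi|) = B + p * `|xi| * B by ring.
have conclude (a1 a2 a3 K : R) : a2 - a1 = a3 -> - a3 <= K -> a1 <= a2 + K by lra.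
by apply: (conclude _ _ _ _ E); lra.
Qed.

End WideStencil.

(** * The limit is a viscosity solution *)

Section TestFunctions.
Context {R : realType} {d : nat}.
Implicit Types phi : 'rV[R]_d * R -> R.

Lemma dtE phi x t : dt phi x t = 'D_(0, 1) phi (x, t).
Proof.
rewrite /dt derive1E /derive.
suff -> : (fun h : R => h^-1 *: (((fun s => phi (x, s)) \o shift t) (h *: 1) - phi (x, t)))
  = (fun h => h^-1 *: ((phi \o shift (x, t)) (h *: (0, 1)) - phi (x, t))) by [].
apply/funext => h /=; congr (h^-1 *: (phi _ - _)).
by apply/eqP; rewrite xpair_eqE /= scaler0 add0r !eqxx.
Qed.

Lemma grad_xE phi x t j : grad_x phi x t 0 j = 'D_(basis_vec j, 0) phi (x, t).
Proof.
rewrite mxE /derive.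
suff -> : (fun h : R => h^-1 *: (((fun y => phi (y, t)) \o shift x) (h *: basis_vec j) - phi (x, t)))
  = (fun h => h^-1 *: ((phi \o shift (x, t)) (h *: (basis_vec j, 0)) - phi (x, t))) by [].
apply/funext => h /=; congr (h^-1 *: (phi _ - _)).
by apply/eqP; rewrite xpair_eqE /= scaler0 add0r !eqxx.
Qed.

Lemma C1N phi : C1 phi -> C1 (- phi).
Proof.
move=> [dphi cphi]; split=> [z|u]; first exact: differentiableN.
have -> : 'D_u (- phi) = - 'D_u phi.
  by apply/funext => z; rewrite deriveN//; exact: diff_derivable.
by move=> z; apply: continuousN; exact: cphi.
Qed.

Lemma deriveN_C1 phi u z : C1 phi -> 'D_u (- phi) z = - 'D_u phi z.
Proof. by move=> [dphi _]; rewrite deriveN//; exact: diff_derivable. Qed.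

End TestFunctions.

Section Limit.
Context {R : realType} {d : nat}.
Hypothesis d_gt0 : (0 < d)%N.
Variable L : 'rV[R]_d -> R -> 'rV[R]_d -> R.
Hypothesis HL : lagrangian L.
Variables (c : 'rV[R]_d) (delta : nat -> mesh) (lambda0 lambda1 : R).
Hypothesis h_small : forall e : R, 0 < e -> \forall n \near \oo, hstep R (delta n) <= e.
Hypothesis tau_small : forall e : R, 0 < e -> \forall n \near \oo, tstep R (delta n) <= e.
Hypothesis lambda0_gt0 : 0 < lambda0.
Hypothesis lambda_ge : forall n, lambda0 <= mesh_ratio R (delta n).
Hypothesis lambda_le : forall n, mesh_ratio R (delta n) <= lambda1.
Variables (v : nat -> int -> 'rV[int]_d -> R) (a : nat -> R).
Variables (g : 'rV[R]_d * R -> R) (H0 C Lambda : R).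
Hypothesis C_ge0 : 0 <= C.
Hypothesis Lambda_ge0 : 0 <= Lambda.
Hypothesis v_unif : forall e, 0 < e -> \forall n \near \oo, forall k m,
  in_dual_grid k m -> `|v n k m - g (xpt R (delta n) m, tpt R (delta n) k)| <= e.
Hypothesis a_cvg : forall e, 0 < e -> \forall n \near \oo, `|a n - H0| <= e.
Hypothesis g_lipschitz : forall z z', `|g z - g z'| <= Lambda * `|z - z'|.
Hypothesis v_le : forall n k m xi, in_grid k m ->
  v n (k + 1) m <= \sum_o jump_prob (delta n) xi o * v n k (m + dir o)
    + tstep R (delta n) * (tilt L c (xpt R (delta n) m) (tpt R (delta n) k) xi + a n).
Hypothesis v_eq : forall n k m, in_grid k m ->
  exists2 xi, `|xi| <= (d%:R * lambda1)^-1 &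
  v n (k + 1) m = \sum_o jump_prob (delta n) xi o * v n k (m + dir o)
    + tstep R (delta n) * (tilt L c (xpt R (delta n) m) (tpt R (delta n) k) xi + a n).
Hypothesis v_slope : forall n k m j, in_grid k m ->
  `|v n k (m + unit_step j) - v n k (m - unit_step j)| <= 2 * hstep R (delta n) * C.
Implicit Types (m : 'rV[int]_d) (k : int).

Let lambda_gt0 n : 0 < mesh_ratio R (delta n).
Proof. exact: lt_le_trans (lambda_ge n). Qed.

Let lambda1_gt0 : 0 < lambda1.
Proof. exact: lt_le_trans (lambda_le 0). Qed.

Let dR0 : 0 < d%:R :> R. Proof. by rewrite ltr0n. Qed.

Lemma cfl_weight n (xi : 'rV[R]_d) o : `|xi| <= (d%:R * lambda1)^-1 -> 0 <= jump_prob (delta n) xi o.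
Proof.
move=> Hxi; apply: jump_prob_ge0 => //; apply: (le_trans Hxi).
have lt0 (x : R) : 0 < x -> 0 < d%:R * x by move=> x0; rewrite mulr_gt0.
by rewrite lef_pV2; [rewrite ler_pM2l|rewrite posrE lt0|rewrite posrE lt0].
Qed.

(** The optimal velocity depends on the grid point, but it stays in the CFL box, on
    which L is equicontinuous in (x, t).  So the running cost may be taken at the
    touching point, where the supremum that defines the Hamiltonian dominates it. *)
Theorem limit_super : viscosity_super (hamiltonian L) c H0 g.
Proof.
move=> phi Cphi x0 t0 Hmin.
have /choice[f Hf] (nkm : nat * int * 'rV[int]_d) : exists xi, in_grid nkm.1.2 nkm.2 ->
    `|xi| <= (d%:R * lambda1)^-1 /\
    v nkm.1.1 (nkm.1.2 + 1) nkm.2 = \sum_o jump_prob (delta nkm.1.1) xi o * v nkm.1.1 nkm.1.2 (nkm.2 + dir o)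
    + tstep R (delta nkm.1.1) * (tilt L c (xpt R (delta nkm.1.1) nkm.2) (tpt R (delta nkm.1.1) nkm.1.2) xi + a nkm.1.1).
  case: nkm => -[n k] m /=; have [km|km] := boolP (in_grid k m); last by exists 0.
  by have [xi H1 H2] := v_eq n km; exists xi.
pose xi n k m := f (n, k, m).
pose Dt := 'D_(0, 1) phi (x0, t0); pose p := grad_x phi x0 t0.
rewrite dtE -/Dt -/p; apply/ler_addgt0Pr => e e0.
have e3 : 0 < e / 3 by rewrite divr_gt0.
have [rho rho0 Hrho] := L_equicontinuous HL (d%:R * lambda1)^-1 x0 t0 e3.
pose e' := Num.min (e / 3) rho.
have e'0 : 0 < e' by rewrite lt_min e3.
have e'e : e' <= e / 3 by rewrite ge_min lexx.
have e'r : e' <= rho by rewrite ge_min lexx orbT.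
pose w n k m := - v n k m.
pose ell n k m := - (tilt L c (xpt R (delta n) m) (tpt R (delta n) k) (xi n k m) + a n).
have gc : continuous (- g) by move=> z; apply: continuousN; exact: (lipschitz_continuous Lambda_ge0 g_lipschitz).
have wu e1 : 0 < e1 -> \forall n \near \oo, forall k m, in_dual_grid k m ->
    `|w n k m - (- g) (xpt R (delta n) m, tpt R (delta n) k)| <= e1.
  move=> /v_unif; apply: filterS => n H k m km.
  by rewrite opprK addrC distrC; exact: H.
have Hm : \forall z \near (x0, t0), (- g) z - (- phi) z <= (- g) (x0, t0) - (- phi) (x0, t0).
  by apply: filterS Hmin => z; rewrite !fctE; lra.
have pos : \forall n \near \oo, forall k m o, in_grid k m ->
    0 <= jump_prob (delta n) ((2 * 0 + 1)%:R^-1 *: xi n k m) o.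
  apply: nearW => n k m o km; rewrite invr1 scale1r; apply: cfl_weight.
  exact: (Hf (n, k, m) km).1.
have sch : \forall n \near \oo, forall k m, in_grid k m -> w n (k + 1) m <=
    \sum_o jump_prob (delta n) ((2 * 0 + 1)%:R^-1 *: xi n k m) o
      * w n k (m + dir o *+ (2 * 0 + 1)) + tstep R (delta n) * ell n k m.
  apply: nearW => n k m km; rewrite invr1 scale1r.
  have [_ E] := Hf (n, k, m) km; rewrite /w /ell E /= opprD -sumrN mulrN lerD2r.
  by apply: ler_sum => o _; rewrite mulr1n mulrN.
have hl := half_limit d_gt0 h_small tau_small gc wu lambda0_gt0 lambda_ge (C1N Cphi) Hm pos sch e'0.
have [n [[k [m [km Hx Ht HD]]] Ha]] := filter_ex (filterI hl (a_cvg e3)).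
have [xiQ _] := Hf (n, k, m) km; rewrite -/(xi n k m) in xiQ.
have := Hrho _ _ _ (le_trans Hx e'r) (le_trans Ht e'r) xiQ.
have := hamiltonian_ge HL x0 t0 (c + p) (xi n k m).
move: HD; rewrite deriveN_C1//.
have -> : \sum_j xi n k m 0 j * 'D_(basis_vec j, 0) (- phi) (x0, t0) = - dot p (xi n k m).
  rewrite /dot -sumrN; apply: eq_bigr => j _.
  by rewrite deriveN_C1// grad_xE mulrN mulrC.
rewrite /ell /tilt dotDl -/Dt; move: Ha; rewrite !ler_norml => /andP[? ?] ? ? /andP[? ?].
lra.
Qed.

Lemma mollified_unif q : (0 < q)%N -> forall e, 0 < e -> \forall n \near \oo, forall k m,
  in_dual_grid k m ->
  `|mollify q (v n) k m - g (xpt R (delta n) m, tpt R (delta n) k)| <= e.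
Proof.
move=> q0 e e0; have e2 : 0 < e / 2 by rewrite divr_gt0.
have qR0 : 0 < q%:R :> R by rewrite ltr0n.
have K0 : 0 < (Lambda + 1) * (d%:R * (2 * q%:R)) by rewrite !mulr_gt0// ltr_wpDl.
have eK : 0 < e / 2 / ((Lambda + 1) * (d%:R * (2 * q%:R))) by rewrite divr_gt0.
near=> n.
have Hv : forall k m, in_dual_grid k m ->
    `|v n k m - g (xpt R (delta n) m, tpt R (delta n) k)| <= e / 2.
  by near: n; exact: v_unif.
have Hh : hstep R (delta n) <= e / 2 / ((Lambda + 1) * (d%:R * (2 * q%:R))).
  by near: n; exact: h_small.
move=> k m km; apply: (slides_close (delta := delta n)) => // m' gm' Hm'.
have km' : in_dual_grid k m' by rewrite dualN gm' -dualN.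
rewrite -(subrKA (g (xpt R (delta n) m', tpt R (delta n) k))).
rewrite (splitr e) (le_trans (ler_normD _ _))// lerD ?Hv//.
apply: (le_trans (g_lipschitz _ _)).
have -> : `|(xpt R (delta n) m', tpt R (delta n) k) - (xpt R (delta n) m, tpt R (delta n) k)|
    = `|xpt R (delta n) m' - xpt R (delta n) m|.
  by rewrite prod_normE /= subrr normr0; apply/max_idPl.
rewrite size_enum_ord in Hm'.
apply: (@le_trans _ _ ((Lambda + 1) * (d%:R * (2 * q%:R * hstep R (delta n))))).
  by apply: ler_pM => //; rewrite lerDl.
have -> : (Lambda + 1) * (d%:R * (2 * q%:R * hstep R (delta n)))
   = hstep R (delta n) * ((Lambda + 1) * (d%:R * (2 * q%:R))) by ring.
by rewrite -ler_pdivlMr.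
Unshelve. all: by end_near.
Qed.

Lemma first_differences n : first_difference_bound (v n) (2 * hstep R (delta n) * C).
Proof.
move=> k m i km; have gm : in_grid k (m + unit_step i) by rewrite stepE.
by have := v_slope n i gm; rewrite addrK -addrA mulr2n.
Qed.

Lemma mollified_scheme q n xi (s : nat) k m : (0 < q)%N -> in_grid k m ->
  mollify q (v n) (k + 1) m <=
    \sum_o jump_prob (delta n) ((2 * s + 1)%:R^-1 *: xi) o * mollify q (v n) k (m + dir o *+ (2 * s + 1))
    + tstep R (delta n) *
      (mollify q (fun k m => tilt L c (xpt R (delta n) m) (tpt R (delta n) k) xi + a n) k m
       + 4 * d%:R * C * s%:R ^+ 2 * (1 + lambda1 * `|xi|) / lambda0 / q%:R).
Proof.
move=> q0 km; have qR0 : 0 < q%:R :> R by rewrite ltr0n.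
have tau0 := tstep_gt0 (R := R) (delta n); have h0 := hstep_gt0 (R := R) (delta n).
have A := slides_scheme q0 (enum 'I_d) (fun k m km => v_le n xi km) km.
have B := wide_stencil d_gt0 (delta n) s xi
  (fun j => mollify_second_difference q0 j (@first_differences n)) km.
apply: (le_trans A); rewrite mulrDr addrA [leRHS]addrAC lerD2r.
apply: (le_trans B); rewrite lerD2l.
have htau : hstep R (delta n) <= tstep R (delta n) / lambda0.
  rewrite ler_pdivlMr// -(mesh_ratioE (R := R) (delta n)) mulrC ler_wpM2r//.
  exact: ltW.
have l1 : 1 + mesh_ratio R (delta n) * `|xi| <= 1 + lambda1 * `|xi|.
  by rewrite lerD2l ler_wpM2r.
have -> : d%:R * (2 * (2 * hstep R (delta n) * C) / q%:R * s%:R ^+ 2 * (1 + mesh_ratio R (delta n) * `|xi|))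
  = (4 * d%:R * C * s%:R ^+ 2 / q%:R) * (hstep R (delta n) * (1 + mesh_ratio R (delta n) * `|xi|)).
  by ring.
have -> : tstep R (delta n) * (4 * d%:R * C * s%:R ^+ 2 * (1 + lambda1 * `|xi|) / lambda0 / q%:R)
  = (4 * d%:R * C * s%:R ^+ 2 / q%:R) * (tstep R (delta n) / lambda0 * (1 + lambda1 * `|xi|)).
  by ring.
apply: ler_wpM2l; first by rewrite divr_ge0 ?mulr_ge0 ?exprn_ge0.
by apply: ler_pM => //; [exact: ltW|rewrite addr_ge0// mulr_ge0// ltW].
Qed.

(** The width of the stencil makes the weights nonnegative for the velocity optimal for
    the test function; the number q of translates is chosen afterwards to absorb the
    error of widening. *)
Theorem limit_sub : viscosity_sub (hamiltonian L) c H0 g.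
Proof.
move=> phi Cphi x0 t0 Hmax.
pose Dt := 'D_(0, 1) phi (x0, t0); pose p := grad_x phi x0 t0.
rewrite dtE -/Dt -/p.
have [Hxi _] := hamiltonian_gradient HL x0 t0 (c + p).
set xi := gradient _ _ in Hxi.
apply/ler_addgt0Pr => e e0.
have e5 : 0 < e / 5 by rewrite divr_gt0.
have [rho rho0 Hrho] := L_equicontinuous HL `|xi| x0 t0 e5.
pose s := Num.truncn (d%:R * lambda1 * `|xi|).
have sJ : d%:R * lambda1 * `|xi| <= (2 * s + 1)%:R.
  rewrite (le_trans (ltW (truncnS_gt _)))// ler_nat -/s; lia.
pose K := 4 * d%:R * C * s%:R ^+ 2 * (1 + lambda1 * `|xi|) / lambda0.
have K0 : 0 <= K.
  by rewrite /K divr_ge0 ?(ltW lambda0_gt0)// !mulr_ge0// addr_ge0// mulr_ge0// ltW.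
pose q := (Num.truncn (K / (e / 5))).+1.
have q0 : (0 < q)%N by [].
have qR0 : 0 < q%:R :> R by rewrite ltr0n.
have Kq : K / q%:R <= e / 5.
  rewrite ler_pdivrMr// mulrC -ler_pdivrMr//; apply: ltW; exact: truncnS_gt.
pose w n := mollify q (v n).
pose F n k m := tilt L c (xpt R (delta n) m) (tpt R (delta n) k) xi + a n.
pose ell n k m := mollify q (F n) k m + e / 5.
pose e' := Num.min (e / 5) (rho / 2).
have e'0 : 0 < e' by rewrite lt_min e5 divr_gt0.
have e'e : e' <= e / 5 by rewrite ge_min lexx.
have e'r : e' <= rho / 2 by rewrite ge_min lexx orbT.
have pos : \forall n \near \oo, forall k m o, in_grid k m ->
    0 <= jump_prob (delta n) ((2 * s + 1)%:R^-1 *: xi) o.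
  apply: nearW => n k m o km; apply: cfl_weight.
  have J0 : 0 < (2 * s + 1)%:R :> R by rewrite ltr0n addn1.
  rewrite normrZ gtr0_norm ?invr_gt0// ler_pdivrMl//.
  by rewrite ler_pdivlMr ?mulr_gt0// mulrC.
have sch : \forall n \near \oo, forall k m, in_grid k m -> w n (k + 1) m <=
    \sum_o jump_prob (delta n) ((2 * s + 1)%:R^-1 *: xi) o
      * w n k (m + dir o *+ (2 * s + 1)) + tstep R (delta n) * ell n k m.
  apply: nearW => n k m km; apply: (le_trans (mollified_scheme n xi s q0 km)).
  by rewrite lerD2l ler_pM2l ?tstep_gt0// lerD2l.
have gc := lipschitz_continuous Lambda_ge0 g_lipschitz.
have hl := half_limit (xi := fun _ _ _ => xi) d_gt0 h_small tau_small gc (mollified_unif q0)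
  lambda0_gt0 lambda_ge Cphi Hmax pos sch e'0.
have dq0 : 0 < d%:R * (2 * q%:R) :> R by rewrite !mulr_gt0.
have hh : 0 < rho / 2 / (d%:R * (2 * q%:R)) by rewrite !divr_gt0.
have [n [[[k [m [km Hx Ht HD]]] Ha] Hh]] :=
  filter_ex (filterI (filterI hl (a_cvg e5)) (h_small hh)).
have close : `|mollify q (F n) k m - (tilt L c x0 t0 xi + a n)| <= e / 5.
  apply: (slides_close (delta := delta n)) => // m' _ Hm'.
  rewrite size_enum_ord in Hm'.
  have Hx' : `|xpt R (delta n) m' - x0| <= rho.
    rewrite -(subrKA (xpt R (delta n) m)) (le_trans (ler_normD _ _))// (splitr rho) lerD//.
      by rewrite (le_trans Hm')// mulrA mulrC -ler_pdivlMr.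
    exact: le_trans e'r.
  have Ht' : `|tpt R (delta n) k - t0| <= rho by rewrite (le_trans Ht)//; lra.
  have := Hrho _ _ xi Hx' Ht' (lexx _).
  by rewrite /F /tilt !ler_norml => /andP[? ?]; apply/andP; split; lra.
have ED : \sum_j xi 0 j * 'D_(basis_vec j, 0) phi (x0, t0) = dot p xi.
  by apply: eq_bigr => j _; rewrite grad_xE mulrC.
move: HD; rewrite ED -/Dt /ell => HD.
rewrite Hxi dotDl.
by move: Ha close; rewrite /tilt !ler_norml => /andP[? ?] /andP[? ?]; lra.
Qed.

End Limit.

(** * Convergence of the scheme *)

Lemma grid_error_le (R : realType) d (delta : mesh) (v : int -> 'rV[int]_d -> R) g (e : R) :
  0 <= e -> (forall k m, in_dual_grid k m ->
    `|v k m - g (xpt R delta m, tpt R delta k)| <= e) ->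
  `|grid_error delta v g| <= e.
Proof.
move=> e0 H; rewrite ger0_norm; last exact: bigmax_ge_id.
by apply: bigmax_le => // -[k m] km; exact: H.
Qed.

Lemma incr_ge (sigma : nat -> nat) : {homo sigma : i j / (i < j)%N} ->
  forall n, (n <= sigma n)%N.
Proof. by move=> s_incr; elim=> // n IH; exact: leq_ltn_trans IH (s_incr _ _ (ltnSn n)). Qed.

Lemma subsequence_small (R : realType) (u : nat -> R) (sigma : nat -> nat) :
  u @ \oo --> (0 : R) -> {homo sigma : i j / (i < j)%N} ->
  forall e, 0 < e -> \forall n \near \oo, u (sigma n) <= e.
Proof.
move=> u0 s_incr e e0; have /cvgrPdist_le/(_ _ e0)[N _ HN] := u0.
exists N => // n /= Nn; have := HN (sigma n) (leq_trans Nn (incr_ge s_incr n)).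
by rewrite /= sub0r normrN; apply: le_trans; rewrite ler_norm.
Qed.

(** The bound of [space_time_bound] for the slope bound C + |c|, divided by tau, after
    estimating h by tau / lambda0. *)
Definition step_constant {R : realType} {d : nat} (lambda0 : R) (c : 'rV[R]_d) (C CH : R) : R :=
  6 * (C + `|c|) / lambda0 + (2 * d%:R + 2) * CH.

Lemma step_constant_ge0 (R : realType) (d : nat) (lambda0 C CH : R) (c : 'rV[R]_d) :
  0 < lambda0 -> 0 < C -> 0 < CH -> 0 <= step_constant lambda0 c C CH.
Proof.
move=> l0 C0 CH0; rewrite addr_ge0 ?divr_ge0 ?mulr_ge0 ?addr_ge0 ?mulr_ge0 //; exact: ltW.
Qed.

Section CellEstimates.
Context {R : realType} {d : nat}.
Hypothesis d_gt0 : (0 < d)%N.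
Variable L : 'rV[R]_d -> R -> 'rV[R]_d -> R.
Hypothesis HL : lagrangian L.
Variables (P : set 'rV[R]_d) (r lambda0 lambda1 : R) (delta : mesh).
Hypothesis lambda0_gt0 : 0 < lambda0.
Hypothesis lambda_bounds : lambda0 <= mesh_ratio R delta < lambda1.
Hypothesis standing : standing_assumption L P r lambda1 delta.
Variables (c : 'rV[R]_d) (a : R) (v : int -> 'rV[int]_d -> R) (M C CH : R).
Hypothesis Pc : P c.
Hypothesis v_sol : periodic_cell_solution (hamiltonian L) delta r c a v.
Hypothesis vM : forall k m, in_dual_grid k m -> `|v k m| <= M.
Hypothesis C_gt0 : 0 < C.
Hypothesis CH_gt0 : 0 < CH.
Hypothesis HC : forall x t z p, `|z| <= (d%:R * lambda1)^-1 ->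
  (forall u, 'D_u (L x t) z = dot p u) -> `|p| <= C.
Hypothesis HCH : forall x t p, `|p| <= C -> `|hamiltonian L x t p| <= CH.
Implicit Types (m : 'rV[int]_d) (k : int).

Let h := hstep R delta.
Let tau := tstep R delta.

Let vDx k m j : in_grid k m ->
  `|v k (m + unit_step j) - v k (m - unit_step j)| <= 2 * h * (C + `|c|).
Proof. by move=> km; exact: (cell_slope d_gt0 HL standing Pc v_sol j HC km). Qed.

Let vDt k m : in_grid k m ->
  `|v (k + 1) m - neighbour_mean (v k) m - tau * a| <= tau * CH.
Proof.
move=> km; rewrite (cell_scheme v_sol km) -/tau.
set X := hamiltonian _ _ _ _.
have -> : neighbour_mean (v k) m + tau * (a - X) - neighbour_mean (v k) m - tau * a = - (tau * X).
  by ring.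
rewrite normrN normrM gtr0_norm ?tstep_gt0//; apply: ler_wpM2l; first exact/ltW/tstep_gt0.
rewrite /X; apply: HCH.
have [_ Hz] := hamiltonian_gradient HL (xpt R delta m) (tpt R delta k) (c + Dx delta (v k) m).
exact: HC (cell_velocity d_gt0 HL standing Pc v_sol km) Hz.
Qed.

Let C'0 : 0 <= C + `|c|. Proof. by rewrite addr_ge0// ltW. Qed.

Lemma cell_rate_bound : `|a| <= CH.
Proof. exact: (@rate_bound R d delta d_gt0 v M CH a vM vDt). Qed.

Let B := step_constant lambda0 c C CH.

Lemma cell_lipschitz z z' :
  `|extend d_gt0 delta v z - extend d_gt0 delta v z'|
    <= (B + d%:R * (B * lambda1)) * `|z - z'|
       + (1 + d%:R) * (B * tau).
Proof.
have tau0 : 0 < tau := tstep_gt0 delta; have h0 : 0 < h := hstep_gt0 delta.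
have /andP[l0 l1] := lambda_bounds.
have htau : h <= tau / lambda0.
  by rewrite ler_pdivlMr// /tau -(mesh_ratioE (R := R) delta) mulrC ler_wpM2r// ltW.
have B6 : 6 * h * (C + `|c|) <= 6 * (C + `|c|) / lambda0 * tau.
  have -> : 6 * (C + `|c|) / lambda0 * tau = 6 * (tau / lambda0) * (C + `|c|) by ring.
  by rewrite ler_wpM2r// ler_wpM2l.
have CHt : 0 <= CH * tau by rewrite mulr_ge0// ltW.
have B0 := step_constant_ge0 c lambda0_gt0 C_gt0 CH_gt0.
apply: extend_lipschitz => //.
- rewrite -mulrA ler_wpM2l// /tau -(mesh_ratioE (R := R) delta).
  by rewrite ler_wpM2r// ltW.
- move=> k m o o' km.
  apply: (le_trans (neighbour_bound d_gt0 C'0 vM vDx vDt o o' km)).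
  by rewrite -/h -/tau /B /step_constant mulrDl; lra.
- move=> k m o km.
  apply: (le_trans (space_time_bound d_gt0 C'0 vM vDx vDt o km)).
  by rewrite -/h -/tau /B /step_constant mulrDl; lra.
Qed.

End CellEstimates.

Unset Implicit Arguments.

Theorem theorem3p10 (R : realType) (d : nat) (d_gt0 : (0 < d)%N)
  (L : 'rV[R]_d -> R -> 'rV[R]_d -> R) (L_lagrangian : lagrangian L)
  (P : set 'rV[R]_d) (P_compact : compact P) (P_convex : convex_set P)
  (r : R) (r_gt0 : 0 < r)
  (lambda0 lambda1 : R) (lambda0_gt0 : 0 < lambda0)
  (delta : nat -> mesh)
  (h_cvg0 : (fun n => hstep R (delta n)) @ \oo --> (0 : R))
  (tau_cvg0 : (fun n => tstep R (delta n)) @ \oo --> (0 : R))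
  (lambda_bounds : forall n, lambda0 <= mesh_ratio R (delta n) < lambda1)
  (standing : forall n, standing_assumption L P r lambda1 (delta n))
  (c : 'rV[R]_d) (Pc : P c)
  (Hbar : R) (Hbar_eff : is_effective_hamiltonian (hamiltonian L) c Hbar)
  (Hbar_delta : nat -> R)
  (Hbar_delta_eff : forall n,
     is_discrete_effective_hamiltonian (hamiltonian L) (delta n) r c (Hbar_delta n))
  (v : nat -> int -> 'rV[int]_d -> R)
  (v_sol : forall n,
     periodic_cell_solution (hamiltonian L) (delta n) r c (Hbar_delta n) (v n))
  (v_bounded : exists M : R, forall n k m, in_dual_grid k m -> `|v n k m| <= M) :
  exists (sigma : nat -> nat) (vbar : 'rV[R]_d * R -> R),
    [/\ {homo sigma : i j / (i < j)%N},
        viscosity_solution (hamiltonian L) c Hbar vbar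
      & (fun n => grid_error (delta (sigma n)) (v (sigma n)) vbar) @ \oo
          --> (0 : R)].
Proof.
have [M vM] := v_bounded.
have [C C0 HC] := slope_bound L_lagrangian (d%:R * lambda1)^-1.
have [CH CH0 HCH] := hamiltonian_bound L_lagrangian C.
have lambda1_gt0 : 0 < lambda1.
  by have /andP[l0 l1] := lambda_bounds 0; rewrite (le_lt_trans _ l1)// (le_trans _ l0)// ltW.
pose B := step_constant lambda0 c C CH.
have B0 : 0 <= B.
  exact: step_constant_ge0.
pose Lambda := B + d%:R * (B * lambda1).
have Lambda0 : 0 <= Lambda by rewrite addr_ge0// !mulr_ge0// ltW.
pose f n := extend d_gt0 (delta n) (v n).
pose eps n := (1 + d%:R) * (B * tstep R (delta n)).
have eps0 : eps @ \oo --> (0 : R).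
  have -> : eps = (fun n => ((1 + d%:R) * B) * tstep R (delta n)).
    by apply/funext => n; rewrite /eps mulrA.
  by rewrite -[X in _ --> X](mulr0 ((1 + d%:R) * B)); apply: cvgMr.
have fM n z : `|f n z| <= Num.max M CH.
  by rewrite le_max (extend_bound d_gt0 (delta n) (vM n)).
have aM n : `|Hbar_delta n| <= Num.max M CH.
  rewrite le_max; apply/orP; right.
  exact (cell_rate_bound d_gt0 L_lagrangian (standing n) Pc (v_sol n) (vM n) HC HCH).
have fL n z z' : `|f n z - f n z'| <= Lambda * `|z - z'| + eps n.
  exact (cell_lipschitz d_gt0 L_lagrangian lambda0_gt0 (lambda_bounds n) (standing n)
    Pc (v_sol n) (vM n) C0 CH0 HC HCH z z').
have fx n j z : f n (z.1 + basis_vec j, z.2) = f n z.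
  apply: extend_period_x => k m km; exact: (cell_periodic_x (v_sol n)).
have ft n z : f n (z.1, z.2 + 1) = f n z.
  apply: extend_period_t => k m km; exact: (cell_periodic_t (v_sol n)).
have [sigma [g [b [s_incr gL gx gt Hunif]]]] :=
  periodic_extraction fM aM Lambda0 eps0 fL fx ft.
exists sigma, g.
have v_unif e : 0 < e -> \forall n \near \oo, forall k m, in_dual_grid k m ->
    `|v (sigma n) k m - g (xpt R (delta (sigma n)) m, tpt R (delta (sigma n)) k)| <= e.
  move=> /Hunif[N HN]; exists N => // n /= Nn k m km.
  have [H _] := HN n Nn.
  by rewrite -(extend_grid d_gt0 (delta (sigma n)) (v (sigma n)) km); exact: H.
have a_cvg e : 0 < e -> \forall n \near \oo, `|Hbar_delta (sigma n) - b| <= e.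
  by move=> /Hunif[N HN]; exists N => // n /= Nn; exact: (HN n Nn).2.
have h_small := subsequence_small h_cvg0 s_incr.
have tau_small := subsequence_small tau_cvg0 s_incr.
have l0 n : lambda0 <= mesh_ratio R (delta (sigma n)) by case/andP: (lambda_bounds (sigma n)).
have l1 n : mesh_ratio R (delta (sigma n)) <= lambda1.
  by case/andP: (lambda_bounds (sigma n)) => _ /ltW.
have gsol : viscosity_solution (hamiltonian L) c b g.
  split.
  - exact: lipschitz_continuous Lambda0 gL.
  - by move=> j x t; exact: (gx j (x, t)).
  - by move=> x t; exact: (gt (x, t)).
  - apply: (limit_sub d_gt0 L_lagrangian h_small tau_small lambda0_gt0 l0 l1 _ Lambda0
      v_unif a_cvg gL _ _).
    + exact: (addr_ge0 (ltW C0) (normr_ge0 c)).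
    + by move=> n k m xi km; exact: cell_control_le.
    + by move=> n k m j km; exact: (cell_slope d_gt0 L_lagrangian (standing _) Pc (v_sol _) j HC km).
  - apply: (limit_super d_gt0 L_lagrangian h_small tau_small lambda0_gt0 l0 l1 Lambda0
      v_unif a_cvg gL _).
    by move=> n k m km; exact: (cell_control_eq d_gt0 L_lagrangian (standing _) Pc (v_sol _)).
have -> : Hbar = b by apply: Hbar_eff.2; exists g.
split => //; apply/cvgrPdist_le => e e0.
apply: filterS (v_unif e e0) => n Hn; rewrite sub0r normrN.
by apply: grid_error_le => //; exact: ltW.
Qed.
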